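(* Modal logics enjoy both the Craig Interpolation Property (CIP) and the Lyndon Interpolation Property (LIP) if they are complete with respect to the class of Kripke models defined by any combination of the following frame properties: 1. reflexivity, transitivity, symmetry, seriality, and Euclideanness; 2. shift reflexivity, shift transitivity, shift symmetry, shift seriality, and shift Euclideanness; 3. any property obtained from one in item 2 by replacing the ''shift'' condition by an arbitrary conjunction of relational atoms; 4. functionality; 5. $(1,n)$-transitivity; 6. strictly irreflexive, strictly reflexive, or unspecified discreteness of the frame; 7. $hijk$-convergence with $h,i,j,k\ge 1$ (in presence of transitivity); 8. $hijk$-convergence with $i,k\ge 1$ and $h,j\ge 2$ (in presence of shift transitivity); 9. density (in presence of transitivity and Euclideanness); 10. $(n,m)$-transitivity for $m<n$ (in presence of transitivity and Euclideanness); for $m\ge n$, $(n,m)$-transitivity follows from transitivity. In particular, the list of logics with the CIP/LIP proved in this way (using labelled sequents) includes all 15 logics of the so-called modal cube; the logics $\mathsf{K4.2}$, $\mathsf{S4.2}$, $\mathsf{Triv}$, $\mathsf{Verum}$, and $\mathsf{K4}_{1,n}$ from the standard table of normal modal logics; as well as the infinite family of non-degenerate Geach logics over $\mathsf{K4}$ and almost the full family of Geach logics over $\mathsf{K5}$ (due to the shift transitivity of the latter).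
   Context: Modal formulas are in negation normal form: built from positive propositional atoms $P$, negative propositional atoms $\overline{P}$, $\top$, $\bot$ by $\wedge,\vee,\Box,\Diamond$; $\overline{A}$ is defined by De Morgan laws and $A\to B:=\overline{A}\vee B$. Kripke frames $(W,R)$ ($W\neq\varnothing$, $R\subseteq W\times W$), Kripke models based on them, and satisfaction are standard; a class of models is defined by frame properties if it consists of all models whose frames have these properties. A logic $\mathsf L$ is complete w.r.t. a class of models if $\mathsf L\vdash A$ iff $A$ holds at every world of every model in the class. LIP for $\mathsf L$: whenever $\mathsf L\vdash A\to B$, there is a formula $C$ with $\mathsf L\vdash A\to C$ and $\mathsf L\vdash C\to B$ such that each positive atom $P$ and each negative atom $\overline{P}$ occurring in $C$ occurs in both $A$ and $B$. CIP: the same with polarities disregarded. Frame properties (free variables universally quantified; a relational atom is an expression $xRy$ in world variables; $R^n$ is the $n$-fold composition of $R$). Reflexivity: $wRw$. Transitivity: $wRo\wedge oRr\to wRr$. Symmetry: $wRo\to oRw$. Seriality: $\exists o\,wRo$. Euclideanness: $wRo\wedge wRr\to oRr$. Shift reflexivity: $wRo\to oRo$. Shift transitivity: $wRo\wedge oRu\wedge uRv\to oRv$. Shift symmetry: $wRo\wedge oRu\to uRo$. Shift seriality: $wRu\to\exists o\,uRo$. Shift Euclideanness: $wRo\wedge oRu\wedge oRv\to uRv$. In the last five, the ''shift'' condition is the first conjunct of the antecedent. Functionality: $wRo\wedge wRu\to o=u$. $(n,m)$-transitivity: $wR^mx\to wR^nx$, i.e. $wRv_1\wedge\ldots\wedge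 v_{m-1}Rx\to\exists y_1\ldots\exists y_{n-1}(wRy_1\wedge\ldots\wedge y_{n-1}Rx)$; in particular, $(1,n)$-transitivity is $w_0Rw_1\wedge\ldots\wedge w_{n-1}Rw_n\to w_0Rw_n$. Strictly irreflexive discreteness: $wRv\to\bot$; unspecified (reflexive or irreflexive) discreteness: $wRu\to w=u$; strictly reflexive discreteness: the latter together with reflexivity. $hijk$-convergence: $wR^hv\wedge wR^ju\to\exists y(vR^iy\wedge uR^ky)$. Density: $wRu\to\exists v(wRv\wedge vRu)$. Named logics. Modal cube: $\mathsf K$, $\mathsf D$, $\mathsf T$, $\mathsf{KB}$, $\mathsf{K4}$, $\mathsf{K5}$, $\mathsf{DB}$, $\mathsf{TB}$, $\mathsf{D4}$, $\mathsf{D5}$, $\mathsf{K45}$, $\mathsf{D45}$, $\mathsf{KB5}$, $\mathsf{S4}$, $\mathsf{S5}$, i.e. the logics of the frame classes given by combinations of seriality ($\mathsf D$), reflexivity ($\mathsf T$), symmetry ($\mathsf B$), transitivity ($4$), Euclideanness ($5$), with $\mathsf{S4}$ for reflexive transitive frames and $\mathsf{S5}$ for equivalence relations. The ''standard table'' is Table 4.2 in Chagrov and Zakharyaschev's book Modal Logic; there $\mathsf{K4.2}$ is $\mathsf{K4}$ plus $\Diamond(p\wedge\Box q)\to\Box(p\vee\Diamond q)$, $\mathsf{S4.2}$ is $\mathsf{S4}$ plus $\Diamond\Box p\to\Box\Diamond p$, $\mathsf{Triv}$ is the logic of reflexive discrete frames (axiom $\Box p\leftrightarrow p$), $\mathsf{Verum}$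 is the logic of irreflexive discrete frames (axiom $\Box p$), and $\mathsf{K4}_{1,n}$ is $\mathsf K$ plus $\Box p\to\Box^n p$. Geach logics over a base logic are its extensions by Scott–Lemmon generalizations $\Diamond^h\Box^i p\to\Box^j\Diamond^k p$ of the Geach axiom, which correspond to $hijk$-convergence; non-degenerate means $h,i,j,k\ge1$. *)

(* Defs.v *)
From Stdlib Require Import List.
Import ListNotations.

Inductive formula : Type :=
| Pos (p : nat)
| Neg (p : nat)
| Top
| Bot
| And (A B : formula)
| Or (A B : formula)
| Box (A : formula)
| Dia (A : formula).

Fixpoint neg (A : formula) : formula :=
  match A with
  | Pos p => Neg p
  | Neg p => Pos p
  | Top => Bot
  | Bot => Top
  | And A B => Or (neg A) (neg B)
  | Or A B => And (neg A) (neg B)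
  | Box A => Dia (neg A)
  | Dia A => Box (neg A)
  end.

Definition Imp (A B : formula) : formula := Or (neg A) B.

Definition Boxn (n : nat) (A : formula) : formula := Nat.iter n Box A.
Definition Dian (n : nat) (A : formula) : formula := Nat.iter n Dia A.

Fixpoint occurs_pos (p : nat) (A : formula) : Prop :=
  match A with
  | Pos q => p = q
  | Neg _ | Top | Bot => False
  | And A B | Or A B => occurs_pos p A \/ occurs_pos p B
  | Box A | Dia A => occurs_pos p A
  end.

Fixpoint occurs_neg (p : nat) (A : formula) : Prop :=
  match A with
  | Neg q => p = q
  | Pos _ | Top | Bot => False
  | And A B | Or A B => occurs_neg p A \/ occurs_neg p B
  | Box A | Dia A => occurs_neg p A
  end.

Definition occurs (p : nat) (A : formula) : Prop :=
  occurs_pos p A \/ occurs_neg p A.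

Record frame : Type := Frame {
  world :> Type;
  acc : world -> world -> Prop;
  world_inhabited : inhabited world
}.
Arguments acc {f} _ _.

Record model : Type := Model {
  model_frame :> frame;
  val : nat -> model_frame -> Prop
}.
Arguments val {m} _ _.

Fixpoint sat (M : model) (w : M) (A : formula) : Prop :=
  match A with
  | Pos p => val p w
  | Neg p => ~ val p w
  | Top => True
  | Bot => False
  | And A B => sat M w A /\ sat M w B
  | Or A B => sat M w A \/ sat M w B
  | Box A => forall v : M, acc w v -> sat M v A
  | Dia A => exists v : M, acc w v /\ sat M v A
  end.

(* A logic is identified with its set of theorems. *)
Definition logic := formula -> Prop.

Definition valid_in (C : model -> Prop) (A : formula) : Prop :=
  forall M : model, C M -> forall w : M, sat M w A.

Definition complete (L : logic) (C : model -> Prop) : Prop :=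
  forall A : formula, L A <-> valid_in C A.

Definition LIP (L : logic) : Prop :=
  forall A B : formula, L (Imp A B) ->
  exists C : formula,
    L (Imp A C) /\ L (Imp C B) /\
    (forall p : nat, occurs_pos p C -> occurs_pos p A /\ occurs_pos p B) /\
    (forall p : nat, occurs_neg p C -> occurs_neg p A /\ occurs_neg p B).

Definition CIP (L : logic) : Prop :=
  forall A B : formula, L (Imp A B) ->
  exists C : formula,
    L (Imp A C) /\ L (Imp C B) /\
    (forall p : nat, occurs p C -> occurs p A /\ occurs p B).

Definition interpolation (L : logic) : Prop := CIP L /\ LIP L.

Definition frame_property := frame -> Prop.

Definition reflexive_fr : frame_property := fun F =>
  forall w : F, acc w w.
Definition transitive_fr : frame_property := fun F =>
  forall w o r : F, acc w o -> acc o r -> acc w r.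
Definition symmetric_fr : frame_property := fun F =>
  forall w o : F, acc w o -> acc o w.
Definition serial_fr : frame_property := fun F =>
  forall w : F, exists o : F, acc w o.
Definition euclidean_fr : frame_property := fun F =>
  forall w o r : F, acc w o -> acc w r -> acc o r.

Definition shift_reflexive : frame_property := fun F =>
  forall w o : F, acc w o -> acc o o.
Definition shift_transitive : frame_property := fun F =>
  forall w o u v : F, acc w o -> acc o u -> acc u v -> acc o v.
Definition shift_symmetric : frame_property := fun F =>
  forall w o u : F, acc w o -> acc o u -> acc u o.
Definition shift_serial : frame_property := fun F =>
  forall w u : F, acc w u -> exists o : F, acc u o.
Definition shift_euclidean : frame_property := fun F =>
  forall w o u v : F, acc w o -> acc o u -> acc o v -> acc u v.

(* A conjunction of relational atoms xRy; world variables are natural numbers,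
   so the atoms may or may not mention the variables o, u, v below. *)
Definition rel_conj := list (nat * nat).

Definition holds_conj (F : frame) (a : nat -> F) (G : rel_conj) : Prop :=
  forall x y : nat, In (x, y) G -> acc (a x) (a y).

(* The shift properties with the condition wRo (wRu for seriality) replaced by
   G; the variables o, u, v are numbered 0, 1, 2. *)
Definition cond_reflexive (G : rel_conj) : frame_property := fun F =>
  forall a : nat -> F, holds_conj F a G -> acc (a 0) (a 0).
Definition cond_transitive (G : rel_conj) : frame_property := fun F =>
  forall a : nat -> F, holds_conj F a G ->
  acc (a 0) (a 1) -> acc (a 1) (a 2) -> acc (a 0) (a 2).
Definition cond_symmetric (G : rel_conj) : frame_property := fun F =>
  forall a : nat -> F, holds_conj F a G ->
  acc (a 0) (a 1) -> acc (a 1) (a 0).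
Definition cond_serial (G : rel_conj) : frame_property := fun F =>
  forall a : nat -> F, holds_conj F a G -> exists o : F, acc (a 1) o.
Definition cond_euclidean (G : rel_conj) : frame_property := fun F =>
  forall a : nat -> F, holds_conj F a G ->
  acc (a 0) (a 1) -> acc (a 0) (a 2) -> acc (a 1) (a 2).

Fixpoint accn (F : frame) (n : nat) (x y : F) : Prop :=
  match n with
  | 0 => x = y
  | S n => exists z : F, acc x z /\ accn F n z y
  end.

Definition functional_fr : frame_property := fun F =>
  forall w o u : F, acc w o -> acc w u -> o = u.
Definition nm_transitive (n m : nat) : frame_property := fun F =>
  forall w x : F, accn F m w x -> accn F n w x.
Definition irreflexive_discrete : frame_property := fun F =>
  forall w v : F, acc w v -> False.
Definition discrete_fr : frame_property := fun F =>
  forall w u : F, acc w u -> w = u.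
Definition reflexive_discrete : frame_property := fun F =>
  discrete_fr F /\ reflexive_fr F.
Definition convergent (h i j k : nat) : frame_property := fun F =>
  forall w v u : F, accn F h w v -> accn F j w u ->
  exists y : F, accn F i v y /\ accn F k u y.
Definition dense_fr : frame_property := fun F =>
  forall w u : F, acc w u -> exists v : F, acc w v /\ acc v u.

Definition has_all (X : frame_property -> Prop) (F : frame) : Prop :=
  forall P : frame_property, X P -> P F.

Definition models_of (X : frame_property -> Prop) (M : model) : Prop :=
  has_all X M.

(* Presence is read semantically: the properties in X force P.  Adding P to X
   then leaves the class of models unchanged, so the same classes arise as with
   membership of P in X; e.g. transitivity and Euclideanness each make shift
   transitivity present. *)
Definition present (P : frame_property) (X : frame_property -> Prop) : Prop :=
  forall F : frame, has_all X F -> P F.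

Inductive listed (X : frame_property -> Prop) : frame_property -> Prop :=
| listed_reflexive : listed X reflexive_fr
| listed_transitive : listed X transitive_fr
| listed_symmetric : listed X symmetric_fr
| listed_serial : listed X serial_fr
| listed_euclidean : listed X euclidean_fr
| listed_shift_reflexive : listed X shift_reflexive
| listed_shift_transitive : listed X shift_transitive
| listed_shift_symmetric : listed X shift_symmetric
| listed_shift_serial : listed X shift_serial
| listed_shift_euclidean : listed X shift_euclidean
| listed_cond_reflexive (G : rel_conj) : listed X (cond_reflexive G)
| listed_cond_transitive (G : rel_conj) : listed X (cond_transitive G)
| listed_cond_symmetric (G : rel_conj) : listed X (cond_symmetric G)
| listed_cond_serial (G : rel_conj) : listed X (cond_serial G)
| listed_cond_euclidean (G : rel_conj) : listed X (cond_euclidean G)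
| listed_functional : listed X functional_fr
| listed_1n_transitive (n : nat) : listed X (nm_transitive 1 n)
| listed_irreflexive_discrete : listed X irreflexive_discrete
| listed_reflexive_discrete : listed X reflexive_discrete
| listed_discrete : listed X discrete_fr
| listed_convergent_transitive (h i j k : nat) :
    1 <= h -> 1 <= i -> 1 <= j -> 1 <= k ->
    present transitive_fr X ->
    listed X (convergent h i j k)
| listed_convergent_shift_transitive (h i j k : nat) :
    1 <= i -> 1 <= k -> 2 <= h -> 2 <= j ->
    present shift_transitive X ->
    listed X (convergent h i j k)
| listed_dense :
    present transitive_fr X -> present euclidean_fr X ->
    listed X dense_fr
| listed_nm_transitive (n m : nat) :
    m < n ->
    present transitive_fr X -> present euclidean_fr X ->
    listed X (nm_transitive n m).

(* An arbitrary set (possibly empty or infinite) of listed properties. *)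
Definition combination (X : frame_property -> Prop) : Prop :=
  forall P : frame_property, X P -> listed X P.

Definition logic_of (l : list frame_property) : logic :=
  valid_in (models_of (fun P => In P l)).

Definition K   : logic := logic_of [].
Definition D   : logic := logic_of [serial_fr].
Definition T   : logic := logic_of [reflexive_fr].
Definition KB  : logic := logic_of [symmetric_fr].
Definition K4  : logic := logic_of [transitive_fr].
Definition K5  : logic := logic_of [euclidean_fr].
Definition DB  : logic := logic_of [serial_fr; symmetric_fr].
Definition TB  : logic := logic_of [reflexive_fr; symmetric_fr].
Definition D4  : logic := logic_of [serial_fr; transitive_fr].
Definition D5  : logic := logic_of [serial_fr; euclidean_fr].
Definition K45 : logic := logic_of [transitive_fr; euclidean_fr].
Definition D45 : logic := logic_of [serial_fr; transitive_fr; euclidean_fr].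
Definition KB5 : logic := logic_of [symmetric_fr; euclidean_fr].
Definition S4  : logic := logic_of [reflexive_fr; transitive_fr].
Definition S5  : logic := logic_of [reflexive_fr; transitive_fr; symmetric_fr].

Definition modal_cube : list logic :=
  [K; D; T; KB; K4; K5; DB; TB; D4; D5; K45; D45; KB5; S4; S5].

Definition Triv  : logic := logic_of [reflexive_discrete].
Definition Verum : logic := logic_of [irreflexive_discrete].

Fixpoint subst (s : nat -> formula) (A : formula) : formula :=
  match A with
  | Pos p => s p
  | Neg p => neg (s p)
  | Top => Top
  | Bot => Bot
  | And A B => And (subst s A) (subst s B)
  | Or A B => Or (subst s A) (subst s B)
  | Box A => Box (subst s A)
  | Dia A => Dia (subst s A)
  end.

(* The least normal modal logic containing L and the axioms in X, for L a logic
   of a class of frames (which already contains all theorems of K). *)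
Inductive extension (L : logic) (X : formula -> Prop) : logic :=
| ext_base A : L A -> extension L X A
| ext_axiom A : X A -> extension L X A
| ext_mp A B : extension L X (Imp A B) -> extension L X A -> extension L X B
| ext_nec A : extension L X A -> extension L X (Box A)
| ext_subst s A : extension L X A -> extension L X (subst s A).

Definition geach (h i j k : nat) : formula :=
  Imp (Dian h (Boxn i (Pos 0))) (Boxn j (Dian k (Pos 0))).

Definition geach_logic (L : logic) (G : nat -> nat -> nat -> nat -> Prop) :
    logic :=
  extension L (fun A => exists h i j k : nat, G h i j k /\ A = geach h i j k).

Definition K4_2 : logic :=
  extension K4
    (eq (Imp (Dia (And (Pos 0) (Box (Pos 1)))) (Box (Or (Pos 0) (Dia (Pos 1)))))).

Definition S4_2 : logic :=
  extension S4 (eq (Imp (Dia (Box (Pos 0))) (Box (Dia (Pos 0))))).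

Definition K4_1n (n : nat) : logic :=
  extension K (eq (Imp (Box (Pos 0)) (Boxn n (Pos 0)))).

(* Main.v *)
(* Suppose A -> B is valid but has no Lyndon interpolant, and let lam be the set of
   formulas in the shared polarised vocabulary.  Compactness yields models M, N of
   the class with worlds w |= A and v |= ~B such that every lam-formula true at w
   is true at v; being ultraproducts, M and N are saturated.  On the set Z of pairs
   (x, y) such that lam-truth passes from x to y, take the frame induced by the
   product of M and N.  Saturation makes both projections behave like bounded
   morphisms, so A and ~B hold at (w, v) under a suitable valuation.  Horn conditions
   pass to this frame because it is a subframe of a product, seriality conditions
   because of the forth property.  For convergence, let C in lam hold at all common
   successors of v1, u1.  By transitivity one of them satisfies Box C, so v1 and hence
   v2 satisfies Dia (Box C), and converging a witness with u2 gives a common successor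
   of v2, u2 satisfying C; by saturation some pair in Z succeeds both (v1, v2) and
   (u1, u2).  The axiomatically presented logics are complete for their frames by the
   canonical model. *)

Require Import Defs.
From Stdlib Require Import List PeanoNat Lia Classical ClassicalEpsilon ProofIrrelevance.
From Stdlib Require Import FunctionalExtensionality PropExtensionality.
From Stdlib Require Cantor.
From mathcomp Require classical_sets filter.
Import ListNotations.
Set Bullet Behavior "Strict Subproofs".

(** * Classical truth of negations, finite conjunctions and disjunctions, and a coding of
    formulas *)

Lemma sat_neg (M : model) (A : formula) :
  forall w : M, sat M w (neg A) <-> ~ sat M w A.
Proof.
  induction A as [p|p| | |A IHA B IHB|A IHA B IHB|A IHA|A IHA]; intros w; simpl.
  - tauto.
  - split; [tauto | apply NNPP].
  - tauto.
  - tauto.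
  - rewrite IHA, IHB. split; [tauto | apply not_and_or].
  - rewrite IHA, IHB. tauto.
  - split.
    + intros [v [Hv H]] H'. apply IHA in H. auto.
    + intros H. apply not_all_ex_not in H as [v H]. exists v.
      rewrite IHA. tauto.
  - split.
    + intros H [v [Hv HA]]. exact (proj1 (IHA v) (H v Hv) HA).
    + intros H v Hv. apply IHA. intros HA. apply H. now exists v.
Qed.

Lemma sat_Imp (M : model) (w : M) (A B : formula) :
  sat M w (Imp A B) <-> (sat M w A -> sat M w B).
Proof. unfold Imp; simpl. rewrite sat_neg. destruct (classic (sat M w A)); tauto. Qed.

Lemma neg_involutive (A : formula) : neg (neg A) = A.
Proof. induction A; simpl; congruence. Qed.

Lemma occurs_neg_formula (p : nat) (A : formula) :
  (occurs_pos p (neg A) <-> occurs_neg p A) /\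
  (occurs_neg p (neg A) <-> occurs_pos p A).
Proof. induction A; simpl in *; tauto. Qed.

Definition Conj (l : list formula) : formula := fold_right And Top l.
Definition Disj (l : list formula) : formula := fold_right Or Bot l.

Lemma sat_Conj (M : model) (w : M) (l : list formula) :
  sat M w (Conj l) <-> forall A, In A l -> sat M w A.
Proof.
  induction l as [|B l IH]; simpl; [tauto|]. rewrite IH. split.
  - intros [HB Hl] A [<-|HA]; auto.
  - auto.
Qed.

Lemma sat_Disj (M : model) (w : M) (l : list formula) :
  sat M w (Disj l) <-> exists A, In A l /\ sat M w A.
Proof.
  induction l as [|B l IH]; simpl; [firstorder|]. rewrite IH. split.
  - intros [HB|[A [HA HsA]]]; eauto.
  - intros [A [[<-|HA] HsA]]; eauto.
Qed.

(** Countability of the language drives both the diagonal argument for saturation and the stages of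
    Lindenbaum's construction. *)
Fixpoint code (A : formula) : nat :=
  match A with
  | Pos p => Cantor.to_nat (0, p)
  | Neg p => Cantor.to_nat (1, p)
  | Top => Cantor.to_nat (2, 0)
  | Bot => Cantor.to_nat (3, 0)
  | And A B => Cantor.to_nat (4, Cantor.to_nat (code A, code B))
  | Or A B => Cantor.to_nat (5, Cantor.to_nat (code A, code B))
  | Box A => Cantor.to_nat (6, code A)
  | Dia A => Cantor.to_nat (7, code A)
  end.

Lemma code_injective (A : formula) : forall B, code A = code B -> A = B.
Proof.
  induction A; intros B E; destruct B; cbn [code] in E;
    apply Cantor.to_nat_inj in E; try discriminate E;
    apply (f_equal snd) in E; cbn [snd] in E;
    try (apply Cantor.to_nat_inj in E; injection E as E E');
    f_equal; auto.
Qed.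

(** A left inverse of [code] obtained by choice; a number that codes nothing yields an arbitrary
    formula. *)
Definition decode (n : nat) : formula :=
  epsilon (inhabits Top) (fun A => code A = n).

Lemma decode_code (A : formula) : decode (code A) = A.
Proof.
  apply code_injective. unfold decode.
  apply (epsilon_spec (inhabits Top) (fun B => code B = code A)). now exists A.
Qed.

(** Cuts [S] down to its members enumerated before [k], so that hypotheses on finite lists apply to
    the k-th approximation of [S]. *)
Lemma finite_part (S : formula -> Prop) (k : nat) :
  exists l, forall A, In A l <-> S A /\ exists i, i < k /\ decode i = A.
Proof.
  induction k as [|k [l Hl]].
  - exists []. intros A. split; [intros []|]. intros [_ [i [Hi _]]]. lia.
  - destruct (classic (S (decode k))) as [HS|HS].
    + exists (decode k :: l). intros A. simpl. rewrite Hl. split.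
      * intros [<-|[HA [i [Hi E]]]]; [eauto|]. split; [auto|]. exists i. auto with arith.
      * intros [HA [i [Hi E]]]. destruct (Nat.eq_dec i k) as [->|n]; [auto|].
        right. split; [auto|]. exists i. split; [lia|auto].
    + exists l. intros A. rewrite Hl. split.
      * intros [HA [i [Hi E]]]. split; [auto|]. exists i. auto with arith.
      * intros [HA [i [Hi E]]]. split; [auto|]. exists i. split; [|auto].
        destruct (Nat.eq_dec i k) as [->|n]; [congruence|lia].
Qed.

(** * Ultraproducts and saturation *)

(** [free_tail] makes the ultrafilter nonprincipal, which the saturation of ultraproducts rests
    on. *)
Record free_ultrafilter (U : (nat -> Prop) -> Prop) : Prop := {
  free_and : forall P Q, U P -> U Q -> U (fun n => P n /\ Q n);
  free_mono : forall P Q : nat -> Prop, (forall n, P n -> Q n) -> U P -> U Q;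
  free_em : forall P, U P \/ U (fun n => ~ P n);
  free_False : ~ U (fun _ => False);
  free_tail : forall k, U (fun n => k <= n)
}.

(** The filter of sets containing a final segment of the numbers is extended to an ultrafilter. *)
Lemma free_ultrafilter_exists : exists U, free_ultrafilter U.
Proof.
  assert (proper : filter.ProperFilter
    (fun P : nat -> Prop => exists k, forall n, k <= n -> P n)).
  { constructor.
    - intros [k H]. exact (H k (le_n k)).
    - constructor.
      + exists 0. intros n _. exact I.
      + intros P Q [k HP] [k' HQ]. exists (k + k'). intros n Hn.
        split; [apply HP | apply HQ]; lia.
      + intros P Q HPQ [k HP]. exists k. intros n Hn. apply HPQ, HP, Hn. }
  destruct (filter.ultraFilterLemma proper) as [U [HU sub]].
  pose proof (@filter.ultra_proper _ _ HU) as HU'.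
  destruct HU' as [nonempty [_ inter mono]].
  exists U. constructor.
  - intros P Q HP HQ. exact (inter P Q HP HQ).
  - intros P Q HPQ HP. exact (mono P Q HPQ HP).
  - intros P. exact (@filter.in_ultra_setVsetC _ _ P HU).
  - exact nonempty.
  - intros k. apply sub. now exists k.
Qed.

Definition large : (nat -> Prop) -> Prop :=
  proj1_sig (constructive_indefinite_description _ free_ultrafilter_exists).

Lemma large_free : free_ultrafilter large.
Proof. exact (proj2_sig (constructive_indefinite_description _ free_ultrafilter_exists)). Qed.

Lemma large_mono (P Q : nat -> Prop) : (forall n, P n -> Q n) -> large P -> large Q.
Proof. apply large_free. Qed.

Lemma large_all (P : nat -> Prop) : (forall n, P n) -> large P.
Proof.
  intros H. apply (large_mono (fun n => 0 <= n)); [auto|]. apply large_free.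
Qed.

Lemma large_const (P : Prop) : large (fun _ => P) <-> P.
Proof.
  split; [|intros H; apply large_all; auto]. intros H. apply NNPP. intros HP.
  apply (free_False _ large_free). revert H. apply large_mono. auto.
Qed.

Lemma large_and (P Q : nat -> Prop) :
  large (fun n => P n /\ Q n) <-> large P /\ large Q.
Proof.
  split.
  - intros H. split; revert H; apply large_mono; tauto.
  - intros [HP HQ]. now apply (free_and _ large_free).
Qed.

Lemma large_not (P : nat -> Prop) : large (fun n => ~ P n) <-> ~ large P.
Proof.
  split.
  - intros H HP. apply (large_const False). pose proof (proj2 (large_and _ _) (conj H HP)) as HF.
    revert HF. apply large_mono. tauto.
  - intros H. destruct (free_em _ large_free P); tauto.
Qed.

Lemma large_or (P Q : nat -> Prop) :
  large (fun n => P n \/ Q n) <-> large P \/ large Q.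
Proof.
  split.
  - intros H. apply NNPP. intros H'. apply not_or_and in H' as [HP HQ].
    rewrite <- large_not in HP, HQ.
    apply (large_const False). pose proof (proj2 (large_and _ _) (conj HP HQ)) as HF.
    pose proof (proj2 (large_and _ _) (conj H HF)) as HF'. revert HF'.
    apply large_mono. tauto.
  - intros [H|H]; revert H; apply large_mono; tauto.
Qed.

Lemma large_mono2 (P Q S : nat -> Prop) :
  (forall n, P n -> Q n -> S n) -> large P -> large Q -> large S.
Proof.
  intros H HP HQ. pose proof (proj2 (large_and _ _) (conj HP HQ)) as HPQ.
  revert HPQ. apply large_mono. intros n [? ?]. auto.
Qed.

Lemma family_inhabited (F : nat -> frame) : inhabited (forall n, F n).
Proof.
  constructor. intros n. exact (epsilon (world_inhabited (F n)) (fun _ => True)).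
Qed.

Definition agree (F : nat -> frame) (f g : forall n, F n) : Prop :=
  large (fun n => f n = g n).

(* A canonical representative of the class of [f]: the ultraproduct consists of
   representatives, which replaces the quotient by [agree]. *)
Definition rep (F : nat -> frame) (f : forall n, F n) : forall n, F n :=
  epsilon (family_inhabited F) (agree F f).

Lemma agree_rep (F : nat -> frame) (f : forall n, F n) : agree F f (rep F f).
Proof.
  unfold rep. apply epsilon_spec. exists f. now apply large_all.
Qed.

Lemma rep_agree (F : nat -> frame) (f g : forall n, F n) :
  agree F f g -> rep F f = rep F g.
Proof.
  intros H. unfold rep. f_equal. apply functional_extensionality. intros h.
  apply propositional_extensionality. unfold agree in *.
  split; intros Hh; apply large_mono2 with (2 := H) (3 := Hh); cbv beta; congruence.
Qed.

Definition ultraworld (F : nat -> frame) : Type := {f : forall n, F n | rep F f = f}.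

Definition coord {F : nat -> frame} (x : ultraworld F) (n : nat) : F n := proj1_sig x n.

Definition class_of (F : nat -> frame) (f : forall n, F n) : ultraworld F :=
  exist (fun f => rep F f = f) (rep F f) (eq_sym (rep_agree F f (rep F f) (agree_rep F f))).

Lemma coord_class_of (F : nat -> frame) (f : forall n, F n) :
  large (fun n => f n = coord (class_of F f) n).
Proof. apply agree_rep. Qed.

Lemma ultraworld_eq (F : nat -> frame) (x y : ultraworld F) :
  large (fun n => coord x n = coord y n) <-> x = y.
Proof.
  split; [|intros ->; now apply large_all].
  destruct x as [f Hf], y as [g Hg]. intros H.
  apply subset_eq_compat. exact (eq_trans (eq_sym Hf) (eq_trans (rep_agree F f g H) Hg)).
Qed.

(** The existential case of the theorem of Los: witnesses are picked coordinatewise, with an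
    arbitrary value where there is none. *)
Lemma large_exists (F : nat -> frame) (Q : forall n, F n -> Prop) :
  large (fun n => exists y, Q n y) <->
  exists y : ultraworld F, large (fun n => Q n (coord y n)).
Proof.
  split.
  - intros H. pose (f := fun n => epsilon (world_inhabited (F n)) (Q n)).
    exists (class_of F f). apply large_mono2 with (2 := H) (3 := coord_class_of F f).
    intros n HQ <-. now apply epsilon_spec.
  - intros [y H]. revert H. apply large_mono. eauto.
Qed.

Definition ultra_frame (F : nat -> frame) : frame :=
  Frame (ultraworld F) (fun x y => large (fun n => acc (coord x n) (coord y n)))
    (match family_inhabited F with inhabits f => inhabits (class_of F f) end).

Definition ultra_model (M : nat -> model) : model :=
  Model (ultra_frame M) (fun p (x : ultraworld M) => large (fun n => val p (coord x n))).

Lemma ultra_accn (F : nat -> frame) (k : nat) : forall x y : ultra_frame F,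
  accn (ultra_frame F) k x y <-> large (fun n => accn (F n) k (coord x n) (coord y n)).
Proof.
  induction k as [|k IH]; intros x y; simpl.
  - symmetry. apply ultraworld_eq.
  - rewrite (large_exists F (fun n z => acc (coord x n) z /\ accn (F n) k z (coord y n))).
    split; intros [z H]; exists z.
    + rewrite large_and, <- IH. exact H.
    + rewrite large_and, <- IH in H. exact H.
Qed.

Theorem los (M : nat -> model) (A : formula) : forall x : ultra_model M,
  sat (ultra_model M) x A <-> large (fun n => sat (M n) (coord x n) A).
Proof.
  assert (dia : forall B (x : ultra_model M),
    (forall y : ultra_model M,
       sat (ultra_model M) y B <-> large (fun n => sat (M n) (coord y n) B)) ->
    sat (ultra_model M) x (Dia B) <-> large (fun n => sat (M n) (coord x n) (Dia B))).
  { intros B x IH. simpl.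
    rewrite (large_exists M (fun n v => acc (coord (x : ultraworld M) n) v /\ sat (M n) v B)).
    split; intros [y H]; exists y.
    - rewrite large_and, <- IH. exact H.
    - rewrite large_and, <- IH in H. exact H. }
  induction A as [p|p| | |A IHA B IHB|A IHA B IHB|A IHA|A IHA]; intros x.
  - reflexivity.
  - simpl. symmetry. apply large_not.
  - simpl. now rewrite large_const.
  - simpl. now rewrite large_const.
  - simpl. rewrite IHA, IHB, large_and. reflexivity.
  - simpl. rewrite IHA, IHB, large_or. reflexivity.
  (* [Box] reduces to [Dia] by duality, so that witnesses are chosen in one case only. *)
  - assert (dual : forall (N : model) (w : N),
      sat N w (Box A) <-> ~ sat N w (Dia (neg A))).
    { intros N w. rewrite <- sat_neg. simpl neg. now rewrite neg_involutive. }
    rewrite dual, dia, <- large_not.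
    + split; apply large_mono; intros n; now rewrite dual.
    + intros y. rewrite sat_neg, IHA, <- large_not.
      split; apply large_mono; intros n; now rewrite sat_neg.
  - apply dia, IHA.
Qed.

(* Diagonalisation: the n-th coordinate is chosen in [S k n] for the largest possible
   [k <= n]. *)
Lemma countable_saturation (F : nat -> frame) (S : nat -> forall n, F n -> Prop) :
  (forall k n y, S (Datatypes.S k) n y -> S k n y) ->
  (forall k, large (fun n => exists y, S k n y)) ->
  exists y : ultra_frame F, forall k, large (fun n => S k n (coord y n)).
Proof.
  intros decr ex.
  assert (decr' : forall k k' n y, k <= k' -> S k' n y -> S k n y).
  { intros k k' n y Hk. induction Hk; auto. }
  (* At each coordinate one world meets all conditions of index at most [m] that are satisfiable
     there: as the conditions decrease, it is enough to meet the last satisfiable one. *)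
  assert (pick : forall n m, exists y, forall k, k <= m -> (exists z, S k n z) -> S k n y).
  { intros n. induction m as [|m [y Hy]].
    - destruct (classic (exists z, S 0 n z)) as [[z Hz]|H].
      + exists z. intros k Hk _. replace k with 0 by lia. exact Hz.
      + destruct (world_inhabited (F n)) as [z]. exists z. intros k Hk [z' Hz'].
        exfalso. apply H. exists z'. apply (decr' 0 k); [lia|auto].
    - destruct (classic (exists z, S (Datatypes.S m) n z)) as [[z Hz]|H].
      + exists z. intros k Hk _. now apply (decr' k (Datatypes.S m)).
      + exists y. intros k Hk Hex. destruct (Nat.eq_dec k (Datatypes.S m)) as [->|ne].
        * contradiction.
        * apply Hy; [lia|auto]. }
  (* The bound is the coordinate itself, so a fixed [k] is within the bound at every [n] from [k]
     on, which is a large set. *)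
  set (f := fun n => proj1_sig (constructive_indefinite_description _ (pick n n))).
  exists (class_of F f). intros k.
  apply large_mono2 with (2 := ex k) (Q := fun n => k <= n /\ f n = coord (class_of F f) n).
  - intros n Hex [Hk <-]. unfold f. destruct constructive_indefinite_description as [y Hy]. auto.
  - rewrite large_and. split; [apply large_free|apply coord_class_of].
Qed.

(** Realisation of modal types inside a set of worlds; when [D] is the set of successors of a world,
    this is the usual modal saturation. *)
Definition compact (M : model) (D : M -> Prop) : Prop :=
  forall S : formula -> Prop,
  (forall l, (forall A, In A l -> S A) -> exists y, D y /\ forall A, In A l -> sat M y A) ->
  exists y, D y /\ forall A, S A -> sat M y A.

(* Common successors suffice: R(v) is the case u = v. *)
Definition saturated (M : model) : Prop :=
  forall v u : M, compact M (fun y => acc v y /\ acc u y).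

Lemma compact_singleton (M : model) (x : M) : compact M (eq x).
Proof.
  intros S H. exists x. split; [auto|]. intros A HA.
  destruct (H [A]) as [y [<- Hy]].
  - intros B [<-|[]]. exact HA.
  - apply Hy. now left.
Qed.

Lemma ultra_compact (M : nat -> model) (E : forall n, M n -> Prop) :
  compact (ultra_model M) (fun y : ultraworld M => large (fun n => E n (coord y n))).
Proof.
  intros S H.
  (* The k-th condition asks for [E] and for those among the first [k] formulas that lie in [S]. *)
  destruct (countable_saturation M
    (fun k n y => E n y /\ forall i, i < k -> S (decode i) -> sat (M n) y (decode i)))
    as [y Hy].
  - intros k n y [HE Hl]. split; auto.
  - intros k. destruct (finite_part S k) as [l Hl].
    destruct (H l) as [y [HE Hy]]; [intros A HA; now apply Hl|].
    assert (HC : sat (ultra_model M) y (Conj l)) by now apply sat_Conj.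
    apply los in HC. apply large_mono2 with (2 := HE) (3 := HC).
    intros n HE' HC'. exists (coord y n). split; [auto|]. intros i Hi HS.
    rewrite sat_Conj in HC'. apply HC', Hl. eauto.
  - exists y. split.
    + generalize (Hy 0). apply large_mono. tauto.
    (* The bound on indices is strict, so [A] is met one stage after its code. *)
    + intros A HA. rewrite los. generalize (Hy (Datatypes.S (code A))). apply large_mono.
      intros n [_ Hn]. rewrite <- (decode_code A). apply Hn; [lia|].
      now rewrite decode_code.
Qed.

Lemma ultra_saturated (M : nat -> model) : saturated (ultra_model M).
Proof.
  intros v u S H.
  destruct (ultra_compact M (fun n y => acc (coord v n) y /\ acc (coord u n) y) S)
    as [y [Hy Hs]].
  - intros l Hl. destruct (H l Hl) as [y [Hy Hs]]. exists y. rewrite large_and. auto.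
  - exists y. rewrite large_and in Hy. auto.
Qed.

Definition ultra_closed (X : frame_property -> Prop) : Prop :=
  forall F : nat -> frame, (forall n, has_all X (F n)) -> has_all X (ultra_frame F).

(** The n-th factor of the ultraproduct satisfies those of the first [n] formulas that lie in [S]; a
    given member of [S] thus holds in all but finitely many factors, and the theorem of Los
    applies. *)
Lemma compactness (X : frame_property -> Prop) (S : formula -> Prop) :
  ultra_closed X ->
  (forall l, (forall A, In A l -> S A) ->
     exists (M : model) (w : M), models_of X M /\ forall A, In A l -> sat M w A) ->
  exists (M : model) (w : M),
    models_of X M /\ saturated M /\ forall A, S A -> sat M w A.
Proof.
  intros closed H.
  assert (H' : forall n, exists M : model, models_of X M /\
    exists w : M, forall i, i < n -> S (decode i) -> sat M w (decode i)).
  { intros n. destruct (finite_part S n) as [l Hl].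
    destruct (H l) as [M [w [HM Hw]]]; [intros A HA; now apply Hl|].
    exists M. split; [auto|]. exists w. intros i Hi HS. apply Hw, Hl. eauto. }
  pose (M := fun n => proj1_sig (constructive_indefinite_description _ (H' n))).
  assert (HM : forall n, models_of X (M n) /\
    exists w : M n, forall i, i < n -> S (decode i) -> sat (M n) w (decode i)).
  { intros n. unfold M. now destruct constructive_indefinite_description. }
  destruct (proj1 (large_exists M
    (fun n w => forall i, i < n -> S (decode i) -> sat (M n) w (decode i)))) as [w Hw].
  { apply large_all. apply HM. }
  exists (ultra_model M), w. split; [|split].
  - apply closed. apply HM.
  - apply ultra_saturated.
  - intros A HA. apply los.
    apply large_mono2 with (2 := Hw) (3 := free_tail _ large_free (Datatypes.S (code A))).
    intros n Hn Hk. rewrite <- (decode_code A). apply Hn; [lia|]. now rewrite decode_code.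
Qed.

(** * Amalgams of saturated models *)

(** Negation is left out because the formulas with prescribed polarities are not closed under it. *)
Record fragment (lam : formula -> Prop) : Prop := {
  fragment_Top : lam Top;
  fragment_Bot : lam Bot;
  fragment_And : forall A B, lam A -> lam B -> lam (And A B);
  fragment_Or : forall A B, lam A -> lam B -> lam (Or A B);
  fragment_Box : forall A, lam A -> lam (Box A);
  fragment_Dia : forall A, lam A -> lam (Dia A)
}.

Lemma fragment_Conj (lam : formula -> Prop) (l : list formula) :
  fragment lam -> (forall A, In A l -> lam A) -> lam (Conj l).
Proof.
  intros frag. induction l as [|A l IH]; simpl; intros H; apply frag; auto.
Qed.

Lemma fragment_Disj (lam : formula -> Prop) (l : list formula) :
  fragment lam -> (forall A, In A l -> lam A) -> lam (Disj l).
Proof.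
  intros frag. induction l as [|A l IH]; simpl; intros H; apply frag; auto.
Qed.

(** Truth passes in one direction only; without closure under negation this is weaker than agreement
    on [lam]. *)
Definition simulated (lam : formula -> Prop) (M N : model) (x : M) (y : N) : Prop :=
  forall C, lam C -> sat M x C -> sat N y C.

(** Compactness is used twice: for a [y] satisfying every [lam]-formula true throughout [D1], then
    for an [x] in [D1] refuting every [lam]-formula false at [y]. *)
Lemma simulated_pair (lam : formula -> Prop) (M N : model) (D1 : M -> Prop) (D2 : N -> Prop) :
  fragment lam -> compact M D1 -> compact N D2 ->
  (forall C, lam C -> (forall x, D1 x -> sat M x C) -> exists y, D2 y /\ sat N y C) ->
  exists x y, D1 x /\ D2 y /\ simulated lam M N x y.
Proof.
  intros frag K1 K2 H.
  destruct (K2 (fun C => lam C /\ forall x, D1 x -> sat M x C)) as [y [Hy HyS]].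
  { intros l Hl. destruct (H (Conj l)) as [y [Hy Hs]].
    - apply fragment_Conj; [auto|]. intros; now apply Hl.
    - intros x Hx. apply sat_Conj. intros A HA. now apply Hl.
    - exists y. split; [auto|]. now apply sat_Conj. }
  destruct (K1 (fun E => exists C, E = neg C /\ lam C /\ ~ sat N y C)) as [x [Hx HxS]].
  (* If no world of [D1] met the finite list, the disjunction of the formulas to be refuted would
     hold throughout [D1], hence at [y], where every disjunct fails. *)
  { intros l Hl. apply NNPP. intros no.
    assert (Hs : sat N y (Disj (map neg l))).
    { apply HyS. split.
      - apply fragment_Disj; [auto|]. intros A HA.
        apply in_map_iff in HA as [B [<- HB]].
        destruct (Hl B HB) as [C [-> [HC _]]]. now rewrite neg_involutive.
      - intros x Hx. apply NNPP. intros Hn. apply no. exists x. split; [auto|].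
        intros A HA. apply NNPP. intros HnA. apply Hn. apply sat_Disj.
        exists (neg A). split; [now apply in_map|]. now apply sat_neg. }
    apply sat_Disj in Hs as [B [HB Hs]]. apply in_map_iff in HB as [A [<- HA]].
    destruct (Hl A HA) as [C [-> [_ Hn]]]. rewrite neg_involutive in Hs. auto. }
  exists x, y. split; [auto|]. split; [auto|]. intros C HC Hs. apply NNPP. intros Hn.
  apply (proj1 (sat_neg M C x)); [apply HxS; eauto | auto].
Qed.

(** A formula [C] true at [x'] makes [Dia C] true at [x], hence at [y]; so [simulated_pair] applies
    to [x'] alone and the successors of [y]. *)
Lemma simulated_forth (lam : formula -> Prop) (M N : model) (x x' : M) (y : N) :
  fragment lam -> saturated N -> simulated lam M N x y -> acc x x' ->
  exists y', acc y y' /\ simulated lam M N x' y'.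
Proof.
  intros frag HN Z Hx.
  destruct (simulated_pair lam M N (eq x') _ frag (compact_singleton M x') (HN y y))
    as [z [y' [<- [[Hy _] Z']]]].
  - intros C HC Hs. destruct (Z (Dia C)) as [y' [Hy HsC]].
    + now apply frag.
    + exists x'. auto.
    + exists y'. auto.
  - eauto.
Qed.

(** Dual to the forth property, with [Box C] transferred in place of [Dia C]. *)
Lemma simulated_back (lam : formula -> Prop) (M N : model) (x : M) (y y' : N) :
  fragment lam -> saturated M -> simulated lam M N x y -> acc y y' ->
  exists x', acc x x' /\ simulated lam M N x' y'.
Proof.
  intros frag HM Z Hy.
  destruct (simulated_pair lam M N _ (eq y') frag (HM x x) (compact_singleton N y'))
    as [x' [z [[Hx _] [<- Z']]]].
  - intros C HC Hs. exists y'. split; [auto|].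
    apply (Z (Box C)); [now apply frag| |auto]. intros v Hv. auto.
  - eauto.
Qed.

Definition amalgam_world (lam : formula -> Prop) (M N : model) : Type :=
  {p : M * N | simulated lam M N (fst p) (snd p)}.

Definition left {lam : formula -> Prop} {M N : model} (p : amalgam_world lam M N) : M :=
  fst (proj1_sig p).
Definition right {lam : formula -> Prop} {M N : model} (p : amalgam_world lam M N) : N :=
  snd (proj1_sig p).

Definition pair_up (lam : formula -> Prop) (M N : model) (x : M) (y : N)
    (Z : simulated lam M N x y) : amalgam_world lam M N := exist _ (x, y) Z.

Lemma amalgam_eq (lam : formula -> Prop) (M N : model) (p q : amalgam_world lam M N) :
  left p = left q -> right p = right q -> p = q.
Proof.
  destruct p as [[x y] Z], q as [[x' y'] Z']. unfold left, right. simpl.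
  intros. apply subset_eq_compat. congruence.
Qed.

Definition amalgam (lam : formula -> Prop) (M N : model)
    (inh : inhabited (amalgam_world lam M N)) : frame :=
  Frame (amalgam_world lam M N)
    (fun p q => acc (left p) (left q) /\ acc (right p) (right q)) inh.

Lemma amalgam_forth (lam : formula -> Prop) (M N : model)
    (inh : inhabited (amalgam_world lam M N)) (p : amalgam lam M N inh) (x : M) :
  fragment lam -> saturated N -> acc (left p) x ->
  exists q : amalgam lam M N inh, acc p q /\ left q = x.
Proof.
  intros frag HN Hx.
  destruct (simulated_forth lam M N (left p) x (right p) frag HN (proj2_sig p) Hx)
    as [y [Hy Z]].
  exists (pair_up lam M N x y Z). simpl. auto.
Qed.

Lemma amalgam_back (lam : formula -> Prop) (M N : model)
    (inh : inhabited (amalgam_world lam M N)) (p : amalgam lam M N inh) (y : N) :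
  fragment lam -> saturated M -> acc (right p) y ->
  exists q : amalgam lam M N inh, acc p q /\ right q = y.
Proof.
  intros frag HM Hy.
  destruct (simulated_back lam M N (left p) (right p) y frag HM (proj2_sig p) Hy)
    as [x [Hx Z]].
  exists (pair_up lam M N x y Z). simpl. auto.
Qed.

Lemma amalgam_accn (lam : formula -> Prop) (M N : model)
    (inh : inhabited (amalgam_world lam M N)) (n : nat) :
  forall p q : amalgam lam M N inh, accn (amalgam lam M N inh) n p q ->
  accn M n (left p) (left q) /\ accn N n (right p) (right q).
Proof.
  induction n as [|n IH]; simpl; intros p q.
  - intros ->. auto.
  - intros [r [[HM HN] Hr]]. apply IH in Hr as [HM' HN']. split; eauto.
Qed.

(** Saturation makes both sets of common successors compact, which reduces the search for [z] to one
    formula at a time. *)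
Lemma amalgam_common_successor (lam : formula -> Prop) (M N : model)
    (inh : inhabited (amalgam_world lam M N)) (v u : amalgam lam M N inh) :
  fragment lam -> saturated M -> saturated N ->
  (forall C, lam C ->
    (forall x, acc (left v) x -> acc (left u) x -> sat M x C) ->
    exists y, acc (right v) y /\ acc (right u) y /\ sat N y C) ->
  exists z : amalgam lam M N inh, acc v z /\ acc u z.
Proof.
  intros frag HM HN sep.
  destruct (simulated_pair lam M N _ _ frag (HM (left v) (left u)) (HN (right v) (right u)))
    as [x [y [[Hx Hx'] [[Hy Hy'] Z]]]].
  - intros C HC Hs. destruct (sep C HC) as [y Hy]; [auto|]. exists y. tauto.
  - exists (pair_up lam M N x y Z). simpl. auto.
Qed.

(** * Preservation of frame properties and Horn clauses *)

(** The two constructions under which the class of models must be closed. The notion is relative to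
    [X] so that convergence can be treated with the help of the transitivity forced by [X]. *)
Definition preserved (X : frame_property -> Prop) (P : frame_property) : Prop :=
  (forall F : nat -> frame, (forall n, has_all X (F n)) -> P (ultra_frame F)) /\
  (forall (lam : formula -> Prop) (M N : model) (inh : inhabited (amalgam_world lam M N)),
     fragment lam -> saturated M -> saturated N -> has_all X M -> has_all X N ->
     P (amalgam lam M N inh)).

Lemma preserved_weaken (X : frame_property -> Prop) (Q P : frame_property) :
  (forall F, Q F -> P F) -> preserved X Q -> preserved X P.
Proof. intros H [HU HA]. split; auto 7. Qed.

Lemma preserved_and (X : frame_property -> Prop) (P Q : frame_property) :
  preserved X P -> preserved X Q -> preserved X (fun F => P F /\ Q F).
Proof. intros [HU HA] [HU' HA']. split; auto 7. Qed.

(** The heads of Horn clauses, together with seriality heads. Apart from convergence, every listed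
    property is such a clause, a conjunction of two, or follows from one under its presence
    conditions. *)
Inductive clause_head : Type :=
| Related (x y : nat)
| Equal (x y : nat)
| Successor (x : nat)
| Absurd.

Definition clause (G : rel_conj) (c : clause_head) : frame_property := fun F =>
  forall a : nat -> F, holds_conj F a G ->
  match c with
  | Related x y => acc (a x) (a y)
  | Equal x y => a x = a y
  | Successor x => exists o, acc (a x) o
  | Absurd => False
  end.

Lemma ultra_holds_conj (F : nat -> frame) (a : nat -> ultra_frame F) (G : rel_conj) :
  holds_conj (ultra_frame F) a G ->
  large (fun n => holds_conj (F n) (fun x => coord (a x : ultraworld F) n) G).
Proof.
  induction G as [|[x y] G IH]; intros H.
  - apply large_all. intros n x y [].
  - apply large_mono2 with
      (P := fun n => acc (coord (a x : ultraworld F) n) (coord (a y : ultraworld F) n))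
      (Q := fun n => holds_conj (F n) (fun x => coord (a x : ultraworld F) n) G).
    + intros n Hxy HG x' y' [E|Hin]; [injection E as <- <-; exact Hxy|now apply HG].
    + apply (H x y). now left.
    + apply IH. intros x' y' Hin. apply H. now right.
Qed.

(** In an ultraproduct the finitely many atoms of [G] hold jointly on a large set. In an amalgam the
    clause is read off the coordinates; for a [Successor] head the forth property lifts the
    successor found on the left. *)
Lemma preserved_clause (X : frame_property -> Prop) (G : rel_conj) (c : clause_head) :
  present (clause G c) X -> preserved X (clause G c).
Proof.
  intros H. split.
  - intros F HF a Ha. apply ultra_holds_conj in Ha.
    assert (HG := fun n => H (F n) (HF n)).
    destruct c as [x y|x y|x|].
    + revert Ha. apply large_mono. intros n Hn. exact (HG n _ Hn).
    + apply ultraworld_eq. revert Ha. apply large_mono. intros n Hn. exact (HG n _ Hn).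
    + apply (large_exists F (fun n o => acc (coord (a x : ultraworld F) n) o)).
      revert Ha. apply large_mono. intros n Hn. exact (HG n _ Hn).
    + apply large_const. revert Ha. apply large_mono. intros n Hn. exact (HG n _ Hn).
  - intros lam M N inh frag HM HN XM XN a Ha.
    assert (GM := H M XM (fun x => left (a x))
      (fun x y Hxy => proj1 (Ha x y Hxy))).
    assert (GN := H N XN (fun x => right (a x))
      (fun x y Hxy => proj2 (Ha x y Hxy))).
    destruct c as [x y|x y|x|].
    + now split.
    + now apply amalgam_eq.
    + destruct GM as [o Ho]. destruct (amalgam_forth lam M N inh (a x) o frag HN Ho) as [q [Hq _]].
      now exists q.
    + exact GM.
Qed.

(** * Convergence under local transitivity *)

Lemma accn_last (F : frame) (n : nat) : forall x y : F,
  accn F (S n) x y <-> exists z, accn F n x z /\ acc z y.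
Proof.
  induction n as [|n IH]; intros x y.
  - simpl. split.
    + intros [z [Hz <-]]. eauto.
    + intros [z [<- Hz]]. eauto.
  - split.
    + intros [z [Hz H]]. apply IH in H as [t [Ht Hy]]. exists t. split; [|auto].
      now exists z.
    + intros [t [[z [Hz Ht]] Hy]]. exists z. split; [auto|]. apply IH. eauto.
Qed.

(** A common form of the two transitivity assumptions: transitivity gives it for every [h], shift
    transitivity for positive [h]. *)
Definition tail_transitive (h : nat) : frame_property := fun F =>
  forall w t x y : F, accn F h w t -> acc t x -> acc x y -> acc t y.

Lemma transitive_tail (h : nat) (F : frame) : transitive_fr F -> tail_transitive h F.
Proof. intros H w t x y _. apply H. Qed.

Lemma shift_transitive_tail (h : nat) (F : frame) :
  1 <= h -> shift_transitive F -> tail_transitive h F.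
Proof.
  intros Hh H w t x y Ht. destruct h as [|h]; [lia|].
  apply accn_last in Ht as [z [_ Hz]]. now apply (H z).
Qed.

(** The last step into [v] starts [h] steps from [w], where transitivity is available, so the extra
    step to [x] is absorbed. *)
Lemma tail_step (F : frame) (h : nat) (w v x : F) :
  tail_transitive h F -> accn F (S h) w v -> acc v x -> accn F (S h) w x.
Proof.
  intros T Hv Hx. apply accn_last in Hv as [t [Ht Hv]].
  apply accn_last. exists t. split; [auto|]. now apply (T w t v x).
Qed.

(** Dropping the first step of the path shows that [v] itself lies [h] steps from some world. *)
Lemma tail_tail (F : frame) (h : nat) (w v x y : F) :
  tail_transitive h F -> accn F (S h) w v -> acc v x -> acc x y -> acc v y.
Proof. intros T [w' [_ Hv]]. now apply (T w'). Qed.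

(** The first two steps of the path are merged repeatedly by transitivity at [v]; one step always
    remains, whence [1 <= i]. *)
Lemma accn_shorten (F : frame) (v y : F) (i m : nat) :
  (forall a b : F, acc v a -> acc a b -> acc v b) ->
  1 <= i <= m -> accn F m v y -> accn F i v y.
Proof.
  intros T. induction m as [|m IH]; intros Hi H; [lia|].
  destruct (Nat.eq_dec i (S m)) as [->|ne]; [auto|].
  apply IH; [lia|]. destruct m as [|m]; [lia|]. destruct H as [a [Ha [b [Hb H]]]].
  exists b. split; [|auto]. now apply (T a b).
Qed.

Lemma tail_shorten (F : frame) (h : nat) (w v y : F) (i m : nat) :
  tail_transitive h F -> accn F (S h) w v -> 1 <= i <= m -> accn F m v y -> accn F i v y.
Proof.
  intros T Hv. apply accn_shorten. intros a b. now apply (tail_tail F h w).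
Qed.

Lemma tail_one (F : frame) (h : nat) (w v y : F) (i : nat) :
  tail_transitive h F -> accn F (S h) w v -> 1 <= i -> accn F i v y -> acc v y.
Proof.
  intros T Hv Hi H. destruct (tail_shorten F h w v y 1 i T Hv) as [z [Hz <-]]; [lia|auto|auto].
Qed.

Lemma amalgam_tail_transitive (lam : formula -> Prop) (M N : model)
    (inh : inhabited (amalgam_world lam M N)) (h : nat) :
  tail_transitive h M -> tail_transitive h N -> tail_transitive h (amalgam lam M N inh).
Proof.
  intros TM TN w t x y Ht [Hx Hx'] [Hy Hy']. apply amalgam_accn in Ht as [HtM HtN].
  split; eauto.
Qed.

(** Only a common successor in one step is found here; the path lengths [i] and [k] are restored in
    [convergent_amalgam]. *)
Lemma convergent_step (lam : formula -> Prop) (M N : model)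
    (inh : inhabited (amalgam_world lam M N)) (h i j k : nat) :
  fragment lam -> saturated M -> saturated N -> 1 <= i -> 1 <= k ->
  tail_transitive h M -> tail_transitive h N ->
  tail_transitive j M -> tail_transitive j N ->
  convergent (S h) i (S j) k M -> convergent (S h) i (S j) k N ->
  forall w v u : amalgam lam M N inh,
  accn (amalgam lam M N inh) (S h) w v -> accn (amalgam lam M N inh) (S j) w u ->
  exists z : amalgam lam M N inh, acc v z /\ acc u z.
Proof.
  intros frag satM satN Hi Hk hM hN jM jN cM cN w v u Hv Hu.
  apply amalgam_accn in Hv as [vM vN]. apply amalgam_accn in Hu as [uM uN].
  apply amalgam_common_successor; auto. intros C HC HsC.
  destruct (cM _ _ _ vM uM) as [y [Hvy Huy]].
  apply (tail_one M h (left w) _ _ _ hM vM Hi) in Hvy.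
  apply (tail_one M j (left w) _ _ _ jM uM Hk) in Huy.
  (* Local transitivity turns successors of [y] into common successors of [left v] and [left u]. *)
  assert (box : sat M y (Box C)).
  { intros z Hz. apply HsC.
    - exact (tail_tail M h _ _ _ _ hM vM Hvy Hz).
    - exact (tail_tail M j _ _ _ _ jM uM Huy Hz). }
  destruct (proj2_sig v (Dia (Box C))) as [y2 [Hvy2 box2]].
  { now apply frag, frag. }
  { now exists y. }
  change (acc (right v) y2) in Hvy2.
  (* [y2] is again [S h] steps from [right w], so convergence applies to it and [right u]. *)
  assert (y2N := tail_step N h _ _ _ hN vN Hvy2).
  destruct (cN _ _ _ y2N uN) as [z [Hyz Huz]].
  apply (tail_one N h (right w) _ _ _ hN y2N Hi) in Hyz.
  apply (tail_one N j (right w) _ _ _ jN uN Hk) in Huz.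
  exists z. split; [|split; [auto|now apply box2]].
  exact (tail_tail N h _ _ _ _ hN vN Hvy2 Hyz).
Qed.

Lemma convergent_amalgam (lam : formula -> Prop) (M N : model)
    (inh : inhabited (amalgam_world lam M N)) (h i j k : nat) :
  fragment lam -> saturated M -> saturated N -> 1 <= i -> 1 <= k ->
  tail_transitive h M -> tail_transitive h N ->
  tail_transitive j M -> tail_transitive j N ->
  convergent (S h) i (S j) k M -> convergent (S h) i (S j) k N ->
  convergent (S h) i (S j) k (amalgam lam M N inh).
Proof.
  intros frag satM satN Hi Hk hM hN jM jN cM cN.
  set (A := amalgam lam M N inh).
  assert (step := convergent_step lam M N inh h i j k frag satM satN Hi Hk hM hN jM jN cM cN).
  fold A in step.
  assert (hA : tail_transitive h A) by now apply amalgam_tail_transitive.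
  assert (jA : tail_transitive j A) by now apply amalgam_tail_transitive.
  (* Convergence of [z] with itself gives a successor in the same position, so paths of every length
     start at [z]. *)
  assert (long : forall n (w z : A), accn A (S h) w z -> accn A (S j) w z ->
                 exists y, accn A n z y).
  { induction n as [|n IH]; intros w z Hz Hz'; [now exists z|].
    destruct (step w z z Hz Hz') as [x [Hx _]].
    destruct (IH w x) as [y Hy].
    - now apply (tail_step A h w z x).
    - now apply (tail_step A j w z x).
    - exists y, x. auto. }
  intros w v u Hv Hu. destruct (step w v u Hv Hu) as [z [Hvz Huz]].
  (* With the step into [z] this yields paths of length [S (i + k)], long enough to be shortened to
     [i] and to [k]. *)
  destruct (long (i + k) w z) as [y Hy].
  - now apply (tail_step A h w v z).
  - now apply (tail_step A j w u z).
  - exists y. split.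
    + apply (tail_shorten A h w v y i (S (i + k)) hA Hv); [lia|]. now exists z.
    + apply (tail_shorten A j w u y k (S (i + k)) jA Hu); [lia|]. now exists z.
Qed.

Lemma preserved_convergent (X : frame_property -> Prop) (h i j k : nat) :
  1 <= i -> 1 <= k ->
  present (tail_transitive h) X -> present (tail_transitive j) X ->
  present (convergent (S h) i (S j) k) X ->
  preserved X (convergent (S h) i (S j) k).
Proof.
  intros Hi Hk Th Tj H. split.
  - intros F HF w v u Hv Hu. apply ultra_accn in Hv, Hu.
    destruct (proj1 (large_exists F (fun n y =>
      accn (F n) i (coord (v : ultraworld F) n) y /\
      accn (F n) k (coord (u : ultraworld F) n) y))) as [y Hy].
    + apply large_mono2 with (2 := Hv) (3 := Hu). intros n Hvn Hun.
      exact (H (F n) (HF n) _ _ _ Hvn Hun).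
    + exists y. rewrite large_and in Hy. now rewrite !ultra_accn.
  - intros. apply convergent_amalgam; auto.
Qed.

(* The frame condition of [K4_2] over transitive frames; it is not an instance of
   [convergent], as [v = u] may be a dead end. *)
Definition weakly_directed : frame_property := fun F =>
  forall w v u : F, acc w v -> acc w u -> v = u \/ exists y, acc v y /\ acc u y.

(** Distinct pairs differ in some coordinate and have a common successor there; forth or back then
    gives both pairs successors, which settles the cases where the other coordinates coincide. *)
Lemma preserved_weakly_directed (X : frame_property -> Prop) :
  present transitive_fr X -> present weakly_directed X -> preserved X weakly_directed.
Proof.
  intros T H. split.
  - intros F HF w v u Hv Hu.
    pose proof (large_mono2 _ _ _ (fun n => H (F n) (HF n) _ _ _) Hv Hu) as D.
    apply large_or in D as [D|D].
    + left. now apply ultraworld_eq.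
    + right. destruct (proj1 (large_exists F _) D) as [y Hy].
      exists y. now apply large_and.
  - intros lam M N inh frag satM satN XM XN w v u [vM vN] [uM uN].
    destruct (classic (v = u)) as [E|ne]; [now left|right].
    assert (TM := T M XM). assert (TN := T N XN).
    assert (HM := H M XM). assert (HN := H N XN).
    assert (serial : (exists q : amalgam lam M N inh, acc v q) /\
                     (exists q : amalgam lam M N inh, acc u q)).
    { destruct (HM _ _ _ vM uM) as [E|[y [Hvy Huy]]].
      - destruct (HN _ _ _ vN uN) as [E'|[y [Hvy Huy]]].
        + exfalso. apply ne. now apply amalgam_eq.
        + destruct (amalgam_back lam M N inh v y) as [q [Hq _]]; auto.
          destruct (amalgam_back lam M N inh u y) as [q' [Hq' _]]; eauto.
      - destruct (amalgam_forth lam M N inh v y) as [q [Hq _]]; auto.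
        destruct (amalgam_forth lam M N inh u y) as [q' [Hq' _]]; eauto. }
    destruct serial as [[qv [qvM _]] [qu [_ quN]]].
    apply amalgam_common_successor; auto. intros C HC HsC.
    assert (common : exists y, acc (left v) y /\ acc (left u) y).
    { destruct (HM _ _ _ vM uM) as [E|Hy]; [|auto]. exists (left qv). split; [auto|congruence]. }
    destruct common as [y [Hvy Huy]].
    destruct (proj2_sig v (Dia (And C (Box C)))) as [y2 [Hvy2 [Hs box]]].
    { apply frag, frag; [auto|]. now apply frag. }
    { exists y. split; [auto|]. split; [now apply HsC|].
      intros z Hz. apply HsC; [exact (TM _ _ _ Hvy Hz)|exact (TM _ _ _ Huy Hz)]. }
    change (acc (right v) y2) in Hvy2.
    (* If [y2] is [right u] itself, any successor of [right u] is common to both sides and satisfies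
       [C] by [Box C]. *)
    destruct (HN _ _ _ (TN _ _ _ vN Hvy2) uN) as [->|[z [Hz Huz]]].
    + exists (right qu). split; [exact (TN _ _ _ Hvy2 quN)|]. split; [auto|].
      now apply box.
    + exists z. split; [exact (TN _ _ _ Hvy2 Hz)|]. split; [auto|]. now apply box.
Qed.

(** * Lyndon interpolation from preservation *)

(** Formulas in negation normal form are monotone in their literals, so along a bounded morphism
    each polarity calls for one inclusion between the valuations. *)
Lemma sat_lift (W M : model) (f : W -> M) (E : formula) :
  (forall x y, acc x y -> acc (f x) (f y)) ->
  (forall x y, acc (f x) y -> exists z, acc x z /\ f z = y) ->
  (forall p x, occurs_pos p E -> val p (f x) -> val p x) ->
  (forall p x, occurs_neg p E -> val p x -> val p (f x)) ->
  forall x, sat M (f x) E -> sat W x E.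
Proof.
  intros hom lift. induction E as [p|p| | |A IHA B IHB|A IHA B IHB|A IHA|A IHA];
    simpl; intros Hpos Hneg x H; auto 10.
  - destruct H; auto 10.
  - destruct H; [left|right]; auto 10.
  - destruct H as [y [Hy Hs]]. apply lift in Hy as [z [Hz <-]]. eauto.
Qed.

Definition shared (A B C : formula) : Prop :=
  (forall p, occurs_pos p C -> occurs_pos p A /\ occurs_pos p B) /\
  (forall p, occurs_neg p C -> occurs_neg p A /\ occurs_neg p B).

Lemma shared_fragment (A B : formula) : fragment (shared A B).
Proof. unfold shared. constructor; simpl; intuition auto; firstorder. Qed.

(** The least valuation that inherits the positive atoms of [A] from the left and those of [neg B],
    the negative atoms of [B], from the right. *)
Definition amalgam_model (A B : formula) (M N : model)
    (inh : inhabited (amalgam_world (shared A B) M N)) : model :=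
  Model (amalgam (shared A B) M N inh)
    (fun p (z : amalgam (shared A B) M N inh) =>
       (occurs_pos p A /\ val p (left z)) \/ (occurs_neg p B /\ val p (right z))).

Lemma sat_amalgam_left (A B : formula) (M N : model)
    (inh : inhabited (amalgam_world (shared A B) M N)) (z : amalgam_model A B M N inh) :
  saturated N -> sat M (left z) A -> sat (amalgam_model A B M N inh) z A.
Proof.
  intros satN.
  apply (sat_lift (amalgam_model A B M N inh) M (fun z => left z)).
  - intros x y Hxy. apply Hxy.
  - intros x y. apply amalgam_forth; [apply shared_fragment|auto].
  - intros p x Hp Hx. left. auto.
  (* If [p] occurs negatively in both [A] and [B], then [Neg p] is shared and its truth passes from
     left to right. *)
  - intros p x Hp [[_ Hx]|[HB Hx]]; [auto|]. apply NNPP. intros Hn.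
    apply (proj2_sig x (Neg p)); [|exact Hn|exact Hx].
    split; simpl; intros q; [tauto|]. intros ->. auto.
Qed.

Lemma sat_amalgam_right (A B : formula) (M N : model)
    (inh : inhabited (amalgam_world (shared A B) M N)) (z : amalgam_model A B M N inh) :
  saturated M -> sat N (right z) (neg B) -> sat (amalgam_model A B M N inh) z (neg B).
Proof.
  intros satM.
  apply (sat_lift (amalgam_model A B M N inh) N (fun z => right z)).
  - intros x y Hxy. apply Hxy.
  - intros x y. apply amalgam_back; [apply shared_fragment|auto].
  - intros p x Hp Hx. apply (proj1 (occurs_neg_formula p B)) in Hp. right. auto.
  (* If [p] occurs positively in both [A] and [B], then [Pos p] is shared and its truth passes from
     left to right. *)
  - intros p x Hp [[HA Hx]|[_ Hx]]; [|auto].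
    apply (proj2 (occurs_neg_formula p B)) in Hp.
    apply (proj2_sig x (Pos p)); [|exact Hx].
    split; simpl; intros q; [|tauto]. intros ->. auto.
Qed.

Theorem preserved_LIP (X : frame_property -> Prop) (L : logic) :
  (forall P, X P -> preserved X P) -> complete L (models_of X) -> LIP L.
Proof.
  intros pres compl A B HAB.
  assert (closed : ultra_closed X) by (intros F HF P HP; now apply pres).
  assert (refute : forall C D, ~ L (Imp C D) -> exists (M : model) (w : M),
    models_of X M /\ sat M w C /\ ~ sat M w D).
  { intros C D H. apply NNPP. intros no. apply H, compl. intros M HM w.
    apply sat_Imp. intros HC. apply NNPP. intros HD. apply no. eauto. }
  apply NNPP. intros no.
  destruct (compactness X (fun E => E = neg B \/ (shared A B E /\ L (Imp A E))) closed)
    as [N [v [HN [satN Hv]]]].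
  { intros l Hl.
    (* Finitely many shared consequences of [A] merge into one; if it had no model in the class
       together with [neg B], it would be an interpolant. *)
    assert (HC : exists C, (shared A B C /\ L (Imp A C)) /\
      forall (M : model) (w : M), sat M w C -> sat M w (neg B) ->
      forall E, In E l -> sat M w E).
    { induction l as [|E l IH].
      - exists Top. split; [split|].
        + apply shared_fragment.
        + apply compl. intros M HM w. apply sat_Imp. simpl. auto.
        + intros M w _ _ E [].
      - destruct IH as [C [[HC LC] H]]; [intros F HF; apply Hl; now right|].
        destruct (Hl E (or_introl eq_refl)) as [->|[HE LE]].
        + exists C. split; [auto|]. intros M w sC sB F [<-|HF]; eauto.
        + exists (And E C). split; [split|].
          * now apply shared_fragment.
          * apply compl. intros M HM w.
            pose proof (proj1 (compl _) LC M HM w) as sC.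
            pose proof (proj1 (compl _) LE M HM w) as sE.
            rewrite sat_Imp in *. simpl. auto.
          * intros M w [sE sC] sB F [<-|HF]; eauto. }
    destruct HC as [C [[HC LC] H]].
    destruct (refute C B) as [M [w [HM [sC sB]]]].
    { intros LCB. apply no. exists C. destruct HC. auto. }
    exists M, w. split; [auto|]. apply H; [auto|]. now apply sat_neg. }
  destruct (compactness X (fun E => E = A \/
      exists D, E = neg D /\ shared A B D /\ ~ sat N v D) closed)
    as [M [w [HM [satM Hw]]]].
  { intros l Hl.
    (* Finitely many shared formulas false at [v] merge into their disjunction; if [A] implied it in
       [L], it would be a shared consequence of [A] and hold at [v]. *)
    assert (HD : exists D, (shared A B D /\ ~ sat N v D) /\
      forall (M : model) (w : M), sat M w A -> ~ sat M w D ->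
      forall E, In E l -> sat M w E).
    { induction l as [|E l IH].
      - exists Bot. split; [split|].
        + apply shared_fragment.
        + simpl. auto.
        + intros M w _ _ E [].
      - destruct IH as [D [[HD nD] H]]; [intros F HF; apply Hl; now right|].
        destruct (Hl E (or_introl eq_refl)) as [->|[D' [-> [HD' nD']]]].
        + exists D. split; [auto|]. intros M w sA sD F [<-|HF]; eauto.
        + exists (Or D' D). split; [split|].
          * now apply shared_fragment.
          * simpl. tauto.
          * simpl. intros M w sA sD F [<-|HF]; [apply sat_neg; tauto|].
            apply H; tauto. }
    destruct HD as [D [[HD nD] H]].
    destruct (refute A D) as [M [w [HM [sA sD]]]].
    { intros LAD. apply nD. apply Hv. right. auto. }
    exists M, w. split; [auto|]. now apply H. }
  assert (Z : simulated (shared A B) M N w v).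
  { intros C HC sC. apply NNPP. intros nC. apply (proj1 (sat_neg M C w)); [|exact sC].
    apply Hw. right. eauto. }
  pose (z := pair_up _ M N w v Z).
  assert (HX : models_of X (amalgam_model A B M N (inhabits z))).
  { intros P HP. destruct (pres P HP) as [_ HA].
    exact (HA _ M N (inhabits z) (shared_fragment A B) satM satN HM HN). }
  pose proof (proj1 (compl _) HAB _ HX z) as HI. rewrite sat_Imp in HI.
  apply (proj1 (sat_neg (amalgam_model A B M N (inhabits z)) B z)).
  - apply sat_amalgam_right; [auto|]. apply Hv. now left.
  - apply HI, sat_amalgam_left; [auto|]. apply Hw. now left.
Qed.

Lemma LIP_CIP (L : logic) : LIP L -> CIP L.
Proof.
  intros H A B HAB. destruct (H A B HAB) as [C [HA [HB [Hpos Hneg]]]].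
  exists C. split; [auto|]. split; [auto|].
  intros p [Hp|Hp]; [apply Hpos in Hp|apply Hneg in Hp]; unfold occurs; tauto.
Qed.

(** * The listed frame properties *)

Lemma holds_conj_nil (F : frame) (a : nat -> F) : holds_conj F a [].
Proof. intros x y []. Qed.

Lemma holds_conj_cons (F : frame) (a : nat -> F) (x y : nat) (G : rel_conj) :
  holds_conj F a ((x, y) :: G) <-> acc (a x) (a y) /\ holds_conj F a G.
Proof.
  split.
  - intros H. split; [apply H; now left|]. intros x' y' Hin. apply H. now right.
  - intros [Hxy HG] x' y' [E|Hin]; [injection E as <- <-; auto|auto].
Qed.

Lemma preserved_by_clause (X : frame_property -> Prop) (P : frame_property)
    (G : rel_conj) (c : clause_head) :
  (forall F, P F <-> clause G c F) -> present P X -> preserved X P.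
Proof.
  intros E H. apply (preserved_weaken X (clause G c)); [intros F; apply E|].
  apply preserved_clause. intros F HF. now apply E, H.
Qed.

(** Paths become sequences of worlds, so that a chain of any length can be the body of a Horn
    clause. *)
Lemma accn_path (F : frame) (n : nat) : forall x y : F,
  accn F n x y <->
  exists a : nat -> F, a 0 = x /\ a n = y /\ forall i, i < n -> acc (a i) (a (S i)).
Proof.
  induction n as [|n IH]; intros x y; simpl.
  - split.
    + intros <-. exists (fun _ => x). split; [auto|]. split; [auto|]. intros i Hi. lia.
    + intros [a [<- [<- _]]]. auto.
  - split.
    + intros [z [Hz H]]. apply IH in H as [a [<- [<- H]]].
      exists (fun i => match i with 0 => x | S i => a i end).
      split; [auto|]. split; [auto|]. intros [|i] Hi; [auto|]. apply H. lia.
    + intros [a [<- [<- H]]]. exists (a 1). split; [apply H; lia|]. apply IH.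
      exists (fun i => a (S i)). split; [auto|]. split; [auto|].
      intros i Hi. apply H. lia.
Qed.

Definition chain (n : nat) : rel_conj := map (fun i => (i, S i)) (seq 0 n).

Lemma holds_chain (F : frame) (a : nat -> F) (n : nat) :
  holds_conj F a (chain n) <-> forall i, i < n -> acc (a i) (a (S i)).
Proof.
  unfold holds_conj, chain. split.
  - intros H i Hi. apply H, in_map_iff. exists i. rewrite in_seq. split; [auto|lia].
  - intros H x y Hin. apply in_map_iff in Hin as [i [E Hi]]. apply in_seq in Hi.
    injection E as <- <-. apply H. lia.
Qed.

Lemma nm_transitive_1n_clause (n : nat) (F : frame) :
  nm_transitive 1 n F <-> clause (chain n) (Related 0 n) F.
Proof.
  split.
  - intros H a Ha. destruct (H (a 0) (a n)) as [z [Hz <-]]; [|exact Hz].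
    apply accn_path. exists a. split; [auto|]. split; [auto|]. now apply holds_chain.
  - intros H w x Hx. apply accn_path in Hx as [a [<- [<- Ha]]].
    exists (a n). split; [|reflexivity]. now apply H, holds_chain.
Qed.

(** The path is prolonged by going round the loop at its end. *)
Lemma accn_loop (F : frame) (m n : nat) (w x : F) :
  acc x x -> m <= n -> accn F m w x -> accn F n w x.
Proof.
  intros Hx Hmn H. induction Hmn; [auto|]. apply accn_last. eauto.
Qed.

Lemma preserved_reflexive (X : frame_property -> Prop) :
  present reflexive_fr X -> preserved X reflexive_fr.
Proof.
  apply (preserved_by_clause X _ [] (Related 0 0)). intros F. split.
  - intros H a _. apply H.
  - intros H w. exact (H (fun _ => w) (holds_conj_nil F _)).
Qed.

Lemma preserved_transitive (X : frame_property -> Prop) :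
  present transitive_fr X -> preserved X transitive_fr.
Proof.
  apply (preserved_by_clause X _ [(0, 1); (1, 2)] (Related 0 2)).
  intros F. split.
  - intros H a Ha. rewrite !holds_conj_cons in Ha. now apply (H _ (a 1)).
  (* The assignment lists the worlds in the order of the variables; the default [w] fills the
     remaining ones. *)
  - intros H w o r Ho Hr. apply (H (fun n => nth n [w; o; r] w)).
    rewrite !holds_conj_cons. auto using holds_conj_nil.
Qed.

Lemma preserved_symmetric (X : frame_property -> Prop) :
  present symmetric_fr X -> preserved X symmetric_fr.
Proof.
  apply (preserved_by_clause X _ [(0, 1)] (Related 1 0)).
  intros F. split.
  - intros H a Ha. rewrite !holds_conj_cons in Ha. now apply H.
  - intros H w o Ho. apply (H (fun n => nth n [w; o] w)).
    rewrite !holds_conj_cons. auto using holds_conj_nil.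
Qed.

Lemma preserved_serial (X : frame_property -> Prop) :
  present serial_fr X -> preserved X serial_fr.
Proof.
  apply (preserved_by_clause X _ [] (Successor 0)). intros F. split.
  - intros H a _. apply H.
  - intros H w. exact (H (fun _ => w) (holds_conj_nil F _)).
Qed.

Lemma preserved_euclidean (X : frame_property -> Prop) :
  present euclidean_fr X -> preserved X euclidean_fr.
Proof.
  apply (preserved_by_clause X _ [(0, 1); (0, 2)] (Related 1 2)).
  intros F. split.
  - intros H a Ha. rewrite !holds_conj_cons in Ha. now apply (H (a 0)).
  - intros H w o r Ho Hr. apply (H (fun n => nth n [w; o; r] w)).
    rewrite !holds_conj_cons. auto using holds_conj_nil.
Qed.

Lemma preserved_shift_reflexive (X : frame_property -> Prop) :
  present shift_reflexive X -> preserved X shift_reflexive.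
Proof.
  apply (preserved_by_clause X _ [(0, 1)] (Related 1 1)).
  intros F. split.
  - intros H a Ha. rewrite !holds_conj_cons in Ha. now apply (H (a 0)).
  - intros H w o Ho. apply (H (fun n => nth n [w; o] w)).
    rewrite !holds_conj_cons. auto using holds_conj_nil.
Qed.

Lemma preserved_shift_transitive (X : frame_property -> Prop) :
  present shift_transitive X -> preserved X shift_transitive.
Proof.
  apply (preserved_by_clause X _ [(0, 1); (1, 2); (2, 3)] (Related 1 3)).
  intros F. split.
  - intros H a Ha. rewrite !holds_conj_cons in Ha. now apply (H (a 0) _ (a 2)).
  - intros H w o u v Ho Hu Hv. apply (H (fun n => nth n [w; o; u; v] w)).
    rewrite !holds_conj_cons. auto using holds_conj_nil.
Qed.

Lemma preserved_shift_symmetric (X : frame_property -> Prop) :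
  present shift_symmetric X -> preserved X shift_symmetric.
Proof.
  apply (preserved_by_clause X _ [(0, 1); (1, 2)] (Related 2 1)).
  intros F. split.
  - intros H a Ha. rewrite !holds_conj_cons in Ha. now apply (H (a 0)).
  - intros H w o u Ho Hu. apply (H (fun n => nth n [w; o; u] w)).
    rewrite !holds_conj_cons. auto using holds_conj_nil.
Qed.

Lemma preserved_shift_serial (X : frame_property -> Prop) :
  present shift_serial X -> preserved X shift_serial.
Proof.
  apply (preserved_by_clause X _ [(0, 1)] (Successor 1)).
  intros F. split.
  - intros H a Ha. rewrite !holds_conj_cons in Ha. now apply (H (a 0)).
  - intros H w u Hu. apply (H (fun n => nth n [w; u] w)).
    rewrite !holds_conj_cons. auto using holds_conj_nil.
Qed.

Lemma preserved_shift_euclidean (X : frame_property -> Prop) :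
  present shift_euclidean X -> preserved X shift_euclidean.
Proof.
  apply (preserved_by_clause X _ [(0, 1); (1, 2); (1, 3)] (Related 2 3)).
  intros F. split.
  - intros H a Ha. rewrite !holds_conj_cons in Ha. now apply (H (a 0) (a 1)).
  - intros H w o u v Ho Hu Hv. apply (H (fun n => nth n [w; o; u; v] w)).
    rewrite !holds_conj_cons. auto using holds_conj_nil.
Qed.

(** The remaining premises join [G] in the body, which gives a Horn clause again; so too for
    symmetry and Euclideanness. *)
Lemma preserved_cond_transitive (X : frame_property -> Prop) (G : rel_conj) :
  present (cond_transitive G) X -> preserved X (cond_transitive G).
Proof.
  apply (preserved_by_clause X _ ((0, 1) :: (1, 2) :: G) (Related 0 2)).
  intros F. split.
  - intros H a Ha. rewrite !holds_conj_cons in Ha. now apply H.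
  - intros H a Ha H1 H2. apply H. now rewrite !holds_conj_cons.
Qed.

Lemma preserved_cond_symmetric (X : frame_property -> Prop) (G : rel_conj) :
  present (cond_symmetric G) X -> preserved X (cond_symmetric G).
Proof.
  apply (preserved_by_clause X _ ((0, 1) :: G) (Related 1 0)).
  intros F. split.
  - intros H a Ha. rewrite !holds_conj_cons in Ha. now apply H.
  - intros H a Ha H1. apply H. now rewrite !holds_conj_cons.
Qed.

Lemma preserved_cond_euclidean (X : frame_property -> Prop) (G : rel_conj) :
  present (cond_euclidean G) X -> preserved X (cond_euclidean G).
Proof.
  apply (preserved_by_clause X _ ((0, 1) :: (0, 2) :: G) (Related 1 2)).
  intros F. split.
  - intros H a Ha. rewrite !holds_conj_cons in Ha. now apply H.
  - intros H a Ha H1 H2. apply H. now rewrite !holds_conj_cons.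
Qed.

Lemma preserved_functional (X : frame_property -> Prop) :
  present functional_fr X -> preserved X functional_fr.
Proof.
  apply (preserved_by_clause X _ [(0, 1); (0, 2)] (Equal 1 2)).
  intros F. split.
  - intros H a Ha. rewrite !holds_conj_cons in Ha. now apply (H (a 0)).
  - intros H w o u Ho Hu. apply (H (fun n => nth n [w; o; u] w)).
    rewrite !holds_conj_cons. auto using holds_conj_nil.
Qed.

Lemma preserved_irreflexive_discrete (X : frame_property -> Prop) :
  present irreflexive_discrete X -> preserved X irreflexive_discrete.
Proof.
  apply (preserved_by_clause X _ [(0, 1)] Absurd).
  intros F. split.
  - intros H a Ha. rewrite !holds_conj_cons in Ha. now apply (H (a 0) (a 1)).
  - intros H w v Hv. apply (H (fun n => nth n [w; v] w)).
    rewrite !holds_conj_cons. auto using holds_conj_nil.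
Qed.

Lemma preserved_discrete (X : frame_property -> Prop) :
  present discrete_fr X -> preserved X discrete_fr.
Proof.
  apply (preserved_by_clause X _ [(0, 1)] (Equal 0 1)).
  intros F. split.
  - intros H a Ha. rewrite !holds_conj_cons in Ha. now apply H.
  - intros H w u Hu. apply (H (fun n => nth n [w; u] w)).
    rewrite !holds_conj_cons. auto using holds_conj_nil.
Qed.

(** Under Euclideanness a successor [u] sees itself and can serve as the intermediate world. *)
Lemma preserved_dense (X : frame_property -> Prop) :
  present euclidean_fr X -> preserved X dense_fr.
Proof.
  intros E. apply (preserved_weaken X euclidean_fr); [|now apply preserved_euclidean].
  intros F H w u Hu. exists u. split; [auto|]. now apply (H w).
Qed.

(** For [m = 0] the property amounts to reflexivity, since transitivity shortens the closed path of
    length [n] to a loop. For positive [m] the end of the path is a successor, hence reflexive by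
    Euclideanness, and the path is prolonged there. *)
Lemma preserved_nm_transitive (X : frame_property -> Prop) (n m : nat) :
  m < n -> present transitive_fr X -> present euclidean_fr X ->
  present (nm_transitive n m) X -> preserved X (nm_transitive n m).
Proof.
  intros Hmn HT HE H. destruct m as [|m].
  - apply (preserved_weaken X reflexive_fr).
    + intros F R w x <-. apply (accn_loop F 0); [apply R|lia|reflexivity].
    + apply preserved_reflexive. intros F HF w.
      destruct (accn_shorten F w w 1 n) as [z [Hz <-]]; [|lia| |exact Hz].
      * intros a b. apply (HT F HF).
      * now apply (H F HF).
  - apply (preserved_weaken X euclidean_fr); [|now apply preserved_euclidean].
    intros F E w x Hx. apply (accn_loop F (S m)); [|lia|auto].
    apply accn_last in Hx as [z [_ Hz]]. now apply (E z).
Qed.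

Lemma present_member (X : frame_property -> Prop) (P : frame_property) :
  X P -> present P X.
Proof. intros HP F HF. now apply HF. Qed.

Lemma preserved_listed (X : frame_property -> Prop) (P : frame_property) :
  X P -> listed X P -> preserved X P.
Proof.
  intros HP HL. apply present_member in HP.
  destruct HL as [| | | | | | | | | |G|G|G|G|G| |n| | | |h i j k Hh Hi Hj Hk HT
                 |h i j k Hi Hk Hh Hj HT|HT HE|n m Hmn HT HE].
  - now apply preserved_reflexive.
  - now apply preserved_transitive.
  - now apply preserved_symmetric.
  - now apply preserved_serial.
  - now apply preserved_euclidean.
  - now apply preserved_shift_reflexive.
  - now apply preserved_shift_transitive.
  - now apply preserved_shift_symmetric.
  - now apply preserved_shift_serial.
  - now apply preserved_shift_euclidean.
  - exact (preserved_clause X G (Related 0 0) HP).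
  - now apply preserved_cond_transitive.
  - now apply preserved_cond_symmetric.
  - exact (preserved_clause X G (Successor 1) HP).
  - now apply preserved_cond_euclidean.
  - now apply preserved_functional.
  - exact (preserved_by_clause X _ _ _ (nm_transitive_1n_clause n) HP).
  - now apply preserved_irreflexive_discrete.
  - apply preserved_and.
    + apply preserved_discrete. intros F HF. now apply (HP F).
    + apply preserved_reflexive. intros F HF. now apply (HP F).
  - now apply preserved_discrete.
  - destruct h as [|h], j as [|j]; try lia.
    apply preserved_convergent; auto; intros F HF; now apply transitive_tail, HT.
  (* The bound 2 leaves the predecessors of [h] and [j] positive, as shift transitivity demands. *)
  - destruct h as [|h], j as [|j]; try lia.
    apply preserved_convergent; auto; intros F HF;
      (apply shift_transitive_tail; [lia|now apply HT]).
  - now apply preserved_dense.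
  - now apply preserved_nm_transitive.
Qed.

Lemma interpolation_listed (X : frame_property -> Prop) (L : logic) :
  combination X -> complete L (models_of X) -> interpolation L.
Proof.
  intros HX compl.
  assert (lip : LIP L).
  { apply (preserved_LIP X); [|auto]. intros P HP. apply preserved_listed; auto. }
  split; [now apply LIP_CIP|auto].
Qed.

(** * Canonical models *)

(** Taking all formulas valid in every model in place of axioms for [K] lets each derivation step be
    checked semantically. *)
Record normal (L : logic) : Prop := {
  normal_valid : forall A, (forall (M : model) (w : M), sat M w A) -> L A;
  normal_mp : forall A B, L (Imp A B) -> L A -> L B;
  normal_nec : forall A, L A -> L (Box A)
}.

(** Closure under necessitation is not asked, since the formulas true at a world lack it. *)
Definition theory (L : logic) (T : formula -> Prop) : Prop :=
  (forall A, L A -> T A) /\ (forall A B, T (Imp A B) -> T A -> T B).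

Lemma theory_consequence (L : logic) (T : formula -> Prop) (A B : formula) :
  normal L -> theory L T -> (forall (M : model) (w : M), sat M w A -> sat M w B) ->
  T A -> T B.
Proof.
  intros norm [sub mp] H. apply mp, sub, norm. intros M w. apply sat_Imp, H.
Qed.

Lemma theory_consequence2 (L : logic) (T : formula -> Prop) (A B C : formula) :
  normal L -> theory L T ->
  (forall (M : model) (w : M), sat M w A -> sat M w B -> sat M w C) ->
  T A -> T B -> T C.
Proof.
  intros norm [sub mp] H HA. apply mp. revert HA. apply mp, sub, norm.
  intros M w. rewrite !sat_Imp. apply H.
Qed.

Lemma theory_And (L : logic) (T : formula -> Prop) (A B : formula) :
  normal L -> theory L T -> T A -> T B -> T (And A B).
Proof.
  intros norm HT. apply (theory_consequence2 L); auto. now split.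
Qed.

Definition maximal (L : logic) (G : formula -> Prop) : Prop :=
  theory L G /\ forall A, G (neg A) <-> ~ G A.

(** Stage [n] adds [decode n] unless its negation is already present. A formula is added by passing
    to all [C] implied by it in the theory, so no notion of derivation from assumptions is
    involved. *)
Fixpoint extend (T : formula -> Prop) (n : nat) : formula -> Prop :=
  match n with
  | 0 => T
  | S n => fun C =>
      (extend T n (neg (decode n)) /\ extend T n C) \/
      (~ extend T n (neg (decode n)) /\ extend T n (Imp (decode n) C))
  end.

Lemma extend_theory (L : logic) (T : formula -> Prop) (n : nat) :
  normal L -> theory L T -> ~ T Bot -> theory L (extend T n) /\ ~ extend T n Bot.
Proof.
  intros norm HT HB. induction n as [|n [IH IHB]]; [auto|].
  simpl. destruct (classic (extend T n (neg (decode n)))) as [D|D]; split.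
  - split.
    + intros A HA. left. split; [auto|]. now apply IH.
    + intros A B [[_ HAB]|[? _]] [[_ HA]|[? _]]; try contradiction.
      left. split; [auto|]. revert HAB HA. apply IH.
  - tauto.
  - split.
    + intros A HA. right. split; [auto|]. apply (theory_consequence L _ A); auto.
      * intros M w. rewrite sat_Imp. auto.
      * now apply IH.
    + intros A B [[? _]|[_ HAB]] [[? _]|[_ HA]]; try contradiction.
      right. split; [auto|]. revert HAB HA. apply (theory_consequence2 L); auto.
      intros M w. rewrite !sat_Imp. auto.
  - intros [[? _]|[_ H]]; [contradiction|]. apply D. revert H.
    apply (theory_consequence L); auto. intros M w. rewrite sat_Imp, sat_neg. auto.
Qed.

Lemma extend_mono (L : logic) (T : formula -> Prop) (n m : nat) (A : formula) :
  normal L -> theory L T -> ~ T Bot -> n <= m -> extend T n A -> extend T m A.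
Proof.
  intros norm HT HB Hnm HA. induction Hnm as [|m _ IH]; [auto|]. simpl.
  destruct (classic (extend T m (neg (decode m)))) as [D|D]; [auto|].
  right. split; [auto|]. revert IH. apply (theory_consequence L); auto.
  - now apply extend_theory.
  - intros M w. rewrite sat_Imp. auto.
Qed.

Lemma lindenbaum (L : logic) (T : formula -> Prop) :
  normal L -> theory L T -> ~ T Bot -> exists G, maximal L G /\ forall A, T A -> G A.
Proof.
  intros norm HT HB.
  assert (ext : forall n, theory L (extend T n) /\ ~ extend T n Bot)
    by (intros n; now apply extend_theory).
  exists (fun A => exists n, extend T n A). split; [split; [split|]|].
  - intros A HA. exists 0. now apply HT.
  - intros A B [n HAB] [m HA]. exists (n + m).
    apply (extend_mono L T n (n + m)) in HAB; auto with arith.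
    apply (extend_mono L T m (n + m)) in HA; auto with arith.
    revert HAB HA. apply ext.
  - intros A. split.
    + intros [n HnA] [m HA].
      apply (extend_mono L T n (n + m)) in HnA; auto with arith.
      apply (extend_mono L T m (n + m)) in HA; auto with arith.
      apply (proj2 (ext (n + m))). revert HnA HA.
      apply (theory_consequence2 L); auto; [apply ext|].
      intros M w. rewrite sat_neg. simpl. auto.
    (* The formula [A] is considered at stage [code A] and is present from the next one on, its
       negation never having entered. *)
    + intros H. apply NNPP. intros H'. apply H. exists (S (code A)). simpl.
      rewrite decode_code. right. split; [intros D; eauto|].
      apply ext, norm. intros M w. now apply sat_Imp.
  - intros A HA. now exists 0.
Qed.

Definition canonical_world (L : logic) : Type := {G : formula -> Prop | maximal L G}.

Definition member {L : logic} (x : canonical_world L) (A : formula) : Prop := proj1_sig x A.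

Definition canonical (L : logic) (inh : inhabited (canonical_world L)) : frame :=
  Frame (canonical_world L) (fun x y => forall A, member x (Box A) -> member y A) inh.

Definition canonical_model (L : logic) (inh : inhabited (canonical_world L)) : model :=
  Model (canonical L inh) (fun p (x : canonical L inh) => member x (Pos p)).

Lemma member_neg (L : logic) (x : canonical_world L) (A : formula) :
  member x (neg A) <-> ~ member x A.
Proof. apply (proj2_sig x). Qed.

Lemma member_theory (L : logic) (x : canonical_world L) : theory L (member x).
Proof. apply (proj2_sig x). Qed.

Lemma member_consequence (L : logic) (x : canonical_world L) (A B : formula) :
  normal L -> (forall (M : model) (w : M), sat M w A -> sat M w B) ->
  member x A -> member x B.
Proof. intros norm. apply (theory_consequence L); [auto|apply member_theory]. Qed.

Lemma member_contradiction (L : logic) (x : canonical_world L) (A B : formula) :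
  normal L -> (forall (M : model) (w : M), sat M w A -> ~ sat M w B) ->
  member x A -> ~ member x B.
Proof.
  intros norm H HA. apply member_neg. revert HA. apply member_consequence; [auto|].
  intros M w. rewrite sat_neg. apply H.
Qed.

Lemma canonical_eq (L : logic) (x y : canonical_world L) :
  (forall A, member x A -> member y A) -> x = y.
Proof.
  intros H.
  assert (E : proj1_sig x = proj1_sig y).
  { apply functional_extensionality. intros A. apply propositional_extensionality.
    split; [apply H|]. intros HA. apply NNPP. intros Hn.
    change (~ member x A) in Hn. apply member_neg, H, member_neg in Hn. contradiction. }
  destruct x as [G HG], y as [G' HG']. now apply subset_eq_compat.
Qed.

Lemma sat_Boxn (M : model) (n : nat) (A : formula) : forall w : M,
  sat M w (Boxn n A) <-> forall v, accn M n w v -> sat M v A.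
Proof.
  unfold Boxn. induction n as [|n IH]; simpl; intros w.
  - split; [intros H v <-; auto|auto].
  - split.
    + intros H v [z [Hz Hv]]. now apply (proj1 (IH z) (H z Hz)).
    + intros H z Hz. apply IH. eauto.
Qed.

Lemma sat_Dian (M : model) (n : nat) (A : formula) : forall w : M,
  sat M w (Dian n A) <-> exists v, accn M n w v /\ sat M v A.
Proof.
  unfold Dian. induction n as [|n IH]; simpl; intros w.
  - split; [eauto|]. now intros [v [<- Hv]].
  - split.
    + intros [z [Hz H]]. apply IH in H as [v [Hv HA]]. eauto.
    + intros [v [[z [Hz Hv]] HA]]. exists z. split; [auto|]. apply IH. eauto.
Qed.

(** Going back from inclusions to paths, the middle world [z] has to contain every [B] with [Box B]
    in [x] and to omit [Boxn n A] for every [A] outside [y]. *)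
Lemma canonical_accn (L : logic) (inh : inhabited (canonical_world L)) (n : nat) :
  normal L -> forall x y : canonical L inh,
  accn (canonical L inh) n x y <-> forall A, member x (Boxn n A) -> member y A.
Proof.
  intros norm. induction n as [|n IH]; intros x y; simpl.
  - split; [now intros <-|]. apply canonical_eq.
  - split.
    + intros [z [Hz H]] A HA. apply (proj1 (IH z y) H), Hz, HA.
    + intros H.
      (* The theory of formulas that [x] boxes up to an exception [Boxn n A] with [A] outside [y];
         the negation of each exception belongs to it. *)
      destruct (lindenbaum L
        (fun B => exists A, ~ member y A /\ member x (Box (Or B (Boxn n A))))) as [G [HG sub]].
      * auto.
      * assert (y0 : ~ member y Bot).
        { apply (member_neg L y Bot). apply member_theory, norm. simpl. auto. }
        split.
        -- intros A HA. exists Bot. split; [auto|]. apply member_theory.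
           apply (normal_nec L norm), (normal_mp L norm A); [|auto]. apply norm.
           intros M w. rewrite sat_Imp. simpl. auto.
        (* The disjunction covers both exceptions and stays outside [y] by maximality. *)
        -- intros A B [C1 [HC1 H1]] [C2 [HC2 H2]]. exists (Or C1 C2). split.
           ++ apply member_neg. apply member_neg in HC1, HC2.
              change (member y (And (neg C1) (neg C2))).
              apply (theory_And L); auto. apply member_theory.
           ++ revert H1 H2. apply (theory_consequence2 L); [auto|apply member_theory|].
              intros M w H1 H2 v Hv. specialize (H1 v Hv). specialize (H2 v Hv).
              cbn [sat] in *. rewrite sat_Imp in H1. rewrite sat_Boxn in *. cbn [sat].
              destruct H2 as [H2|H2]; [|right; auto].
              destruct H1 as [H1|H1]; [left; auto|right; auto].
      * intros [A [HA HB]]. apply HA, H. revert HB. apply member_consequence; [auto|].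
        intros M w. simpl. intros HB v Hv. destruct (HB v Hv) as [[]|]; auto.
      * exists (exist _ G HG : canonical_world L).
        assert (Hz : forall C, member x (Box C) -> G C).
        { intros C HC. apply sub. exists Bot. split.
          - apply (member_neg L y Bot). apply member_theory, norm. simpl. auto.
          - revert HC. apply member_consequence; [auto|]. simpl. auto. }
        split; [exact Hz|]. apply IH. intros A HA. apply NNPP. intros Hn.
        assert (HA' : G (neg (Boxn n A))).
        { apply sub. exists A. split; [auto|]. apply member_theory, norm.
          intros M w v Hv. cbn [sat]. rewrite sat_neg. destruct (classic (sat M v (Boxn n A))); tauto. }
        apply (proj2 HG) in HA'. contradiction.
Qed.

Lemma truth (L : logic) (inh : inhabited (canonical_world L)) (A : formula) :
  normal L -> forall x : canonical_model L inh,
  sat (canonical_model L inh) x A <-> member x A.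
Proof.
  intros norm.
  assert (box : forall (x : canonical_world L) B, member x (Box B) <->
    forall y : canonical_world L, (forall C, member x (Box C) -> member y C) -> member y B).
  { intros x B. split; [auto|]. intros H. apply NNPP. intros Hn.
    (* The formulas forced at every successor that refutes [B]; they are consistent because [Box B]
       is missing from [x]. *)
    destruct (lindenbaum L (fun C => member x (Box (Imp (neg B) C)))) as [G [HG sub]].
    - auto.
    - split.
      + intros C HC. apply member_theory. apply (normal_nec L norm), (normal_mp L norm C); [|auto].
        apply norm. intros M w. rewrite !sat_Imp. auto.
      + intros C D. apply (theory_consequence2 L); [auto|apply member_theory|].
        intros M w HC HD v Hv. specialize (HC v Hv). specialize (HD v Hv).
        rewrite !sat_Imp in *. auto.
    - intros HB. apply Hn. revert HB. apply member_consequence; [auto|].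
      intros M w HB v Hv. specialize (HB v Hv). rewrite sat_Imp, sat_neg in HB.
      apply NNPP. exact HB.
    - apply (proj1 (proj2 HG B)).
      + apply sub. apply member_theory, norm. intros M w v Hv. now apply sat_Imp.
      + apply (H (exist _ G HG)). intros C HC. apply sub. revert HC.
        apply member_consequence; [auto|]. intros M w HC v Hv. apply sat_Imp. auto. }
  induction A as [p|p| | |A IHA B IHB|A IHA B IHB|A IHA|A IHA]; intros x.
  - reflexivity.
  - symmetry. apply (member_neg L x (Pos p)).
  - split; [intros _|simpl; auto]. apply member_theory, norm. simpl. auto.
  - split; [intros []|]. apply (member_neg L x Bot). apply member_theory, norm. simpl. auto.
  - simpl. rewrite IHA, IHB. split.
    + intros [HA HB]. apply (theory_And L); auto. apply member_theory.
    + intros H. split; revert H; apply member_consequence; simpl; tauto.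
  - simpl. rewrite IHA, IHB. split.
    + intros [H|H]; revert H; apply member_consequence; simpl; tauto.
    + intros H. apply NNPP. intros Hn. apply not_or_and in Hn as [HA HB].
      apply member_neg in HA, HB.
      apply (member_contradiction L x (And (neg A) (neg B)) (Or A B)); auto.
      * intros M w. simpl. rewrite !sat_neg. tauto.
      * apply (theory_And L); auto. apply member_theory.
  - rewrite box. split; intros H y Hy; apply IHA, H; exact Hy.
  - assert (dual : member x (Dia A) <-> ~ member x (Box (neg A))).
    { rewrite <- member_neg. simpl neg. now rewrite neg_involutive. }
    rewrite dual, box. split.
    + intros [y [Hy HA]] H. apply IHA in HA. revert HA. now apply member_neg, H.
    + intros H. apply not_all_ex_not in H as [y H]. apply imply_to_and in H as [Hy H].
      exists y. split; [exact Hy|]. apply IHA. apply NNPP. intros Hn.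
      apply H. now apply member_neg.
Qed.

Lemma canonical_complete (L : logic) (X : frame_property -> Prop) :
  normal L -> (forall A, L A -> valid_in (models_of X) A) ->
  (forall inh : inhabited (canonical_world L), has_all X (canonical L inh)) ->
  complete L (models_of X).
Proof.
  intros norm sound HX A. split; [auto|]. intros valid. apply NNPP. intros HA.
  (* The consequences of [neg A] in [L], consistent because [A] is no theorem. *)
  destruct (lindenbaum L (fun B => L (Imp (neg A) B))) as [G [HG sub]].
  - auto.
  - split.
    + intros B. apply (normal_mp L norm). apply norm. intros M w. rewrite !sat_Imp. auto.
    + intros B C HBC. apply (normal_mp L norm). revert HBC. apply (normal_mp L norm).
      apply norm. intros M w. rewrite !sat_Imp. auto.
  - intros HB. apply HA. revert HB. apply (normal_mp L norm). apply norm. intros M w.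
    rewrite !sat_Imp, sat_neg. simpl. intros H. now apply NNPP.
  - pose (x := exist _ G HG : canonical_world L).
    apply (proj1 (proj2 HG A)).
    + apply sub, norm. intros M w. now apply sat_Imp.
    + apply (truth L (inhabits x) A norm x). apply valid. apply HX.
Qed.

(** * Canonicity of the Geach and weak directedness schemata *)

Definition geach_instance (h i j k : nat) (A : formula) : formula :=
  Imp (Dian h (Boxn i A)) (Boxn j (Dian k A)).

Lemma sat_geach (M : model) (h i j k : nat) (A : formula) (w : M) :
  convergent h i j k M -> sat M w (geach_instance h i j k A).
Proof.
  intros H. apply sat_Imp. intros HA. apply sat_Dian in HA as [v [Hv HA]].
  rewrite sat_Boxn in *. intros u Hu. destruct (H w v u Hv Hu) as [y [Hvy Huy]].
  apply sat_Dian. exists y. auto.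
Qed.

(** The meeting world extends the union of what [v] boxes [i] times and what [u] boxes [k] times. If
    that were inconsistent, some [B] boxed by [u] would have [neg B] boxed by [v]; the schema for
    [neg B] then puts [Dian k (neg B)] into [u], a contradiction. *)
Lemma canonical_convergent (L : logic) (inh : inhabited (canonical_world L)) (h i j k : nat) :
  normal L -> (forall A, L (geach_instance h i j k A)) ->
  convergent h i j k (canonical L inh).
Proof.
  intros norm ax w v u Hv Hu. rewrite canonical_accn in Hv, Hu by auto.
  destruct (lindenbaum L (fun C =>
    exists B, member u (Boxn k B) /\ member v (Boxn i (Imp B C)))) as [G [HG sub]].
  - auto.
  - split.
    + intros C HC. exists Top. split.
      * apply member_theory, norm. intros M x. apply sat_Boxn. simpl. auto.
      * assert (Hn : L (Boxn i (Imp Top C))).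
        { unfold Boxn. clear -norm HC. induction i as [|i IH]; simpl.
          - revert HC. apply (normal_mp L norm). apply norm. intros M x.
            rewrite !sat_Imp. auto.
          - now apply (normal_nec L norm). }
        now apply member_theory.
    + intros C D [B1 [H1 H1']] [B2 [H2 H2']]. exists (And B1 B2). split.
      * revert H1 H2. apply (theory_consequence2 L); [auto|apply member_theory|].
        intros M x. rewrite !sat_Boxn. simpl. auto.
      * revert H1' H2'. apply (theory_consequence2 L); [auto|apply member_theory|].
        intros M x. rewrite !sat_Boxn. intros H1' H2' y Hy.
        specialize (H1' y Hy). specialize (H2' y Hy). rewrite !sat_Imp in *. simpl. tauto.
  - intros [B [HuB HvB]].
    assert (dia : member w (Dian h (Boxn i (neg B)))).
    { apply NNPP. intros Hn. apply member_neg in Hn.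
      apply (member_contradiction L v (Boxn i (Imp B Bot)) (neg (Boxn i (neg B)))); auto.
      - intros M x. rewrite sat_neg, !sat_Boxn. intros H1 H2. apply H2. intros y Hy.
        specialize (H1 y Hy). rewrite sat_Imp in H1. now apply sat_neg.
      - apply Hv. revert Hn. apply member_consequence; [auto|]. intros M x.
        rewrite sat_neg, sat_Dian, sat_Boxn. intros Hn y Hy. rewrite sat_neg. eauto. }
    apply (member_contradiction L u (Boxn k B) (Dian k (neg B))); auto.
    + intros M x. rewrite sat_Boxn, sat_Dian. intros H [y [Hy Hn]].
      apply sat_neg in Hn. auto.
    + apply Hu. revert dia. apply member_theory. apply member_theory, ax.
  - exists (exist _ G HG : canonical_world L). split; apply canonical_accn; auto.
    + intros A HA. apply sub. exists Top. split.
      * apply member_theory, norm. intros M x. apply sat_Boxn. simpl. auto.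
      * revert HA. apply member_consequence; [auto|]. intros M x. rewrite !sat_Boxn.
        intros HA y Hy. rewrite sat_Imp. auto.
    + intros A HA. apply sub. exists A. split; [auto|]. apply member_theory, norm.
      intros M x. apply sat_Boxn. intros y _. now apply sat_Imp.
Qed.

(** If [v] and [u] differ, some [A] lies in [v] but not in [u]. Should what they box be jointly
    inconsistent through [B], the schema for [A] and [neg B] would put [A] or [Dia (neg B)] into
    [u], which contains [Box B] but not [A]. *)
Lemma canonical_weakly_directed (L : logic) (inh : inhabited (canonical_world L)) :
  normal L ->
  (forall A B, L (Imp (Dia (And A (Box B))) (Box (Or A (Dia B))))) ->
  weakly_directed (canonical L inh).
Proof.
  intros norm ax w v u Hv Hu. apply NNPP. intros Hn. apply not_or_and in Hn as [ne no].
  apply ne. apply canonical_eq. intros A HA. apply NNPP. intros HnA.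
  apply no. destruct (lindenbaum L (fun C =>
    exists B, member u (Box B) /\ member v (Box (Imp B C)))) as [G [HG sub]].
  - auto.
  - split.
    + intros C HC. exists Top. split.
      * apply member_theory, norm. simpl. auto.
      * apply member_theory. apply (normal_nec L norm), (normal_mp L norm C); [|auto].
        apply norm. intros M x. rewrite !sat_Imp. auto.
    + intros C D [B1 [H1 H1']] [B2 [H2 H2']]. exists (And B1 B2). split.
      * revert H1 H2. apply (theory_consequence2 L); [auto|apply member_theory|].
        intros M x. simpl. auto.
      * revert H1' H2'. apply (theory_consequence2 L); [auto|apply member_theory|].
        intros M x H1' H2' y Hy.
        specialize (H1' y Hy). specialize (H2' y Hy). rewrite !sat_Imp in *. simpl. tauto.
  - intros [B [HuB HvB]].
    assert (dia : member w (Dia (And A (Box (neg B))))).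
    { apply NNPP. intros H. apply member_neg in H. apply Hv in H.
      apply (member_contradiction L v (Box (Imp B Bot)) (Dia (neg (neg B)))); auto.
      - intros M x H1 [y [Hy H2]]. specialize (H1 y Hy).
        rewrite neg_involutive in H2. rewrite sat_Imp in H1. exact (H1 H2).
      - revert HA H. apply (theory_consequence2 L); [auto|apply member_theory|].
        intros M x. simpl. rewrite sat_neg. tauto. }
    apply HnA. assert (H : member u (Or A (Dia (neg B)))).
    { apply Hu. revert dia. apply member_theory. apply member_theory, ax. }
    revert HuB H. apply (theory_consequence2 L); [auto|apply member_theory|].
    intros M x HB [H|[y [Hy H]]]; [auto|]. apply sat_neg in H. now apply HB in Hy.
  - exists (exist _ G HG : canonical_world L). split.
    + intros C HC. apply sub. exists Top. split.
      * apply member_theory, norm. simpl. auto.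
      * revert HC. apply member_consequence; [auto|].
        intros M x HC y Hy. rewrite sat_Imp. auto.
    + intros C HC. apply sub. exists C. split; [auto|]. apply member_theory, norm.
      intros M x y _. now apply sat_Imp.
Qed.

(** * Axiomatic extensions and their completeness *)

(** A substitution acts as a change of valuation on the same frame, so validity over a class given
    by frame properties is closed under it. *)
Lemma sat_subst (M : model) (s : nat -> formula) (A : formula) : forall w : M,
  sat M w (subst s A) <-> sat (Model M (fun p w => sat M w (s p))) w A.
Proof.
  induction A; intros w; simpl; try tauto.
  - apply sat_neg.
  - now rewrite IHA1, IHA2.
  - now rewrite IHA1, IHA2.
  - split; intros H v Hv; apply IHA, H, Hv.
  - split; intros [v [Hv H]]; exists v; (split; [auto|now apply IHA]).
Qed.

Lemma subst_neg (s : nat -> formula) (A : formula) : subst s (neg A) = neg (subst s A).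
Proof. induction A; simpl; rewrite ?neg_involutive; congruence. Qed.

Lemma subst_geach (h i j k : nat) (A : formula) :
  subst (fun _ => A) (geach h i j k) = geach_instance h i j k A.
Proof.
  assert (boxn : forall n B, subst (fun _ => A) (Boxn n B) = Boxn n (subst (fun _ => A) B)).
  { unfold Boxn. induction n as [|n IH]; simpl; congruence. }
  assert (dian : forall n B, subst (fun _ => A) (Dian n B) = Dian n (subst (fun _ => A) B)).
  { unfold Dian. induction n as [|n IH]; simpl; congruence. }
  unfold geach, geach_instance, Imp. cbn [subst].
  now rewrite subst_neg, boxn, !dian, boxn.
Qed.

Lemma extension_normal (l : list frame_property) (Ax : formula -> Prop) :
  normal (extension (logic_of l) Ax).
Proof.
  constructor.
  - intros A H. apply ext_base. intros M _ w. apply H.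
  - intros A B. apply ext_mp.
  - intros A. apply ext_nec.
Qed.

Lemma extension_sound (X : frame_property -> Prop) (L : logic) (Ax : formula -> Prop) :
  (forall A, L A -> valid_in (models_of X) A) ->
  (forall A, Ax A -> valid_in (models_of X) A) ->
  forall A, extension L Ax A -> valid_in (models_of X) A.
Proof.
  intros HL HAx A H.
  induction H as [A HA|A HA|A B _ IHAB _ IHA|A _ IHA|s A _ IHA]; auto.
  - intros M HM w. generalize (IHAB M HM w). rewrite sat_Imp. auto.
  - intros M HM w v _. now apply IHA.
  - intros M HM w. apply sat_subst. now apply IHA.
Qed.

Lemma extension_complete (X : frame_property -> Prop) (l : list frame_property)
    (Ax : formula -> Prop) :
  (forall P, In P l -> X P) ->
  (forall A, Ax A -> valid_in (models_of X) A) ->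
  (forall inh, has_all X (canonical (extension (logic_of l) Ax) inh)) ->
  complete (extension (logic_of l) Ax) (models_of X).
Proof.
  intros sub HAx HX. apply canonical_complete; [apply extension_normal| |exact HX].
  apply extension_sound; [|auto]. intros A HA M HM. apply HA. intros P HP. now apply HM, sub.
Qed.

(** A base property that is an instance of convergence makes its Geach schema valid in the base
    logic, and the schema is canonical. *)
Lemma canonical_base (l : list frame_property) (Ax : formula -> Prop) (P : frame_property)
    (h i j k : nat) inh :
  In P l -> (forall F, P F <-> convergent h i j k F) ->
  P (canonical (extension (logic_of l) Ax) inh).
Proof.
  intros HP E. apply E. apply canonical_convergent; [apply extension_normal|].
  intros A. apply ext_base. intros M HM w. apply sat_geach, E, HM, HP.
Qed.

Lemma canonical_geach (l : list frame_property) (Ax : formula -> Prop) (h i j k : nat) inh :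
  Ax (geach h i j k) -> convergent h i j k (canonical (extension (logic_of l) Ax) inh).
Proof.
  intros HAx. apply canonical_convergent; [apply extension_normal|].
  intros A. rewrite <- subst_geach. now apply ext_subst, ext_axiom.
Qed.

(** Reflexivity, transitivity and Euclideanness are degenerate instances of convergence, so one
    canonicity argument serves for base properties and added axioms. *)
Lemma reflexive_convergent (F : frame) : reflexive_fr F <-> convergent 0 1 0 0 F.
Proof.
  split.
  - intros H w v u <- <-. exists w. split; [|reflexivity]. exists w. split; [auto|reflexivity].
  - intros H w. destruct (H w w w) as [y [[z [Hz E]] E']]; try reflexivity.
    simpl in *. congruence.
Qed.

Lemma nm_transitive_1n_convergent (n : nat) (F : frame) :
  nm_transitive 1 n F <-> convergent 0 1 n 0 F.
Proof.
  split.
  - intros H w v u <- Hu. exists u. split; [now apply H|reflexivity].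
  - intros H w x Hx. destruct (H w w x) as [y [Hy <-]]; auto. reflexivity.
Qed.

Lemma transitive_convergent (F : frame) : transitive_fr F <-> convergent 0 1 2 0 F.
Proof.
  rewrite <- nm_transitive_1n_convergent. split.
  - intros H w x [y [Hy [z [Hz <-]]]]. exists z. split; [now apply (H _ y)|reflexivity].
  - intros H w o r Ho Hr. destruct (H w r) as [z [Hz <-]]; [|auto].
    exists o. split; [auto|]. now exists r.
Qed.

Lemma euclidean_convergent (F : frame) : euclidean_fr F <-> convergent 1 0 1 1 F.
Proof.
  split.
  - intros H w v u [v' [Hv <-]] [u' [Hu <-]]. exists v'. split; [reflexivity|].
    exists v'. split; [now apply (H w)|reflexivity].
  - intros H w o r Ho Hr. destruct (H w r o) as [y [<- [z [Hz E]]]].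
    + now exists r.
    + now exists o.
    + simpl in E. congruence.
Qed.

(** The successor [o] sees itself, so [u] sees [o] as well as [v], and Euclideanness at [u] gives
    the edge. *)
Lemma euclidean_shift_transitive (F : frame) : euclidean_fr F -> shift_transitive F.
Proof.
  intros H w o u v Ho Hu Hv. assert (Hoo := H _ _ _ Ho Ho).
  exact (H _ _ _ (H _ _ _ Hu Hoo) Hv).
Qed.

(** * Interpolation for the named logics *)

Lemma interpolation_logic_of (l : list frame_property) :
  (forall X P, In P l -> listed X P) -> interpolation (logic_of l).
Proof.
  intros H. apply (interpolation_listed (fun P => In P l)); [intros P; apply H|].
  intros A. reflexivity.
Qed.

(** The class is cut out by the base property and the possibly infinite set of convergence
    conditions in [G]; each axiom is canonical separately. *)
Lemma interpolation_geach (base : frame_property) (G : nat -> nat -> nat -> nat -> Prop)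
    (h0 i0 j0 k0 : nat) :
  (forall F, base F <-> convergent h0 i0 j0 k0 F) -> (forall X, listed X base) ->
  (forall X h i j k, present base X -> G h i j k -> listed X (convergent h i j k)) ->
  interpolation (geach_logic (logic_of [base]) G).
Proof.
  intros E Hb HG.
  pose (X := fun P => P = base \/ exists h i j k, G h i j k /\ P = convergent h i j k).
  apply (interpolation_listed X).
  - intros P [->|[h [i [j [k [Hg ->]]]]]]; [auto|]. apply HG; [|auto].
    apply present_member. now left.
  - apply extension_complete.
    + intros P [<-|[]]. now left.
    + intros A [h [i [j [k [Hg ->]]]]] M HM w. apply sat_geach. apply HM. right.
      exists h, i, j, k. auto.
    + intros inh P [->|[h [i [j [k [Hg ->]]]]]].
      * apply (canonical_base [base] _ base h0 i0 j0 k0); [now left|auto].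
      * apply canonical_geach. exists h, i, j, k. auto.
Qed.

(** [weakly_directed] is not among the listed properties, so the argument goes through
    [preserved_LIP] directly. *)
Lemma interpolation_K4_2 : interpolation K4_2.
Proof.
  assert (lip : LIP K4_2).
  { pose (X := fun P => In P [transitive_fr; weakly_directed]).
    assert (T : present transitive_fr X) by (apply present_member; now left).
    assert (W : present weakly_directed X) by (apply present_member; right; now left).
    apply (preserved_LIP X).
    - intros P [<-|[<-|[]]].
      + now apply preserved_transitive.
      + now apply preserved_weakly_directed.
    - apply extension_complete.
      + intros P [<-|[]]. now left.
      + intros A <- M HM w. apply sat_Imp. intros [v [Hv [Hp Hq]]] u Hu.
        destruct (W M HM _ _ _ Hv Hu) as [<-|[y [Hy Hy']]].
        * now left.
        * right. exists y. split; [auto|]. now apply Hq.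
      + intros inh P [<-|[<-|[]]].
        * apply (canonical_base [transitive_fr] _ transitive_fr 0 1 2 0); [now left|].
          apply transitive_convergent.
        * apply canonical_weakly_directed; [apply extension_normal|]. intros A B.
          pose proof (ext_subst K4 _ (fun p => match p with 0 => A | _ => B end) _
            (ext_axiom K4 _ _ (eq_refl (Imp (Dia (And (Pos 0) (Box (Pos 1))))
              (Box (Or (Pos 0) (Dia (Pos 1)))))))) as H.
          exact H. }
  split; [now apply LIP_CIP|auto].
Qed.

Lemma interpolation_S4_2 : interpolation S4_2.
Proof.
  pose (X := fun P => In P [reflexive_fr; transitive_fr; convergent 1 1 1 1]).
  assert (T : present transitive_fr X) by (apply present_member; right; now left).
  apply (interpolation_listed X).
  - intros P [<-|[<-|[<-|[]]]].
    + constructor.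
    + constructor.
    + now apply listed_convergent_transitive.
  - apply extension_complete.
    + intros P [<-|[<-|[]]]; [now left|right; now left].
    (* The axiom unfolds to the Geach formula with all four exponents equal to 1. *)
    + intros A <- M HM w. apply (sat_geach M 1 1 1 1). apply HM. right. right. now left.
    + intros inh P [<-|[<-|[<-|[]]]].
      * apply (canonical_base [reflexive_fr; transitive_fr] _ reflexive_fr 0 1 0 0).
        -- now left.
        -- apply reflexive_convergent.
      * apply (canonical_base [reflexive_fr; transitive_fr] _ transitive_fr 0 1 2 0).
        -- right. now left.
        -- apply transitive_convergent.
      * apply canonical_geach. reflexivity.
Qed.

Lemma interpolation_K4_1n (n : nat) : interpolation (K4_1n n).
Proof.
  apply (interpolation_listed (eq (nm_transitive 1 n))).
  - intros P <-. constructor.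
  - apply extension_complete.
    + intros P [].
    (* The axiom unfolds to the Geach formula with [h = k = 0], [i = 1] and [j = n]. *)
    + intros A <- M HM w. apply (sat_geach M 0 1 n 0).
      apply nm_transitive_1n_convergent. now apply HM.
    + intros inh P <-. apply nm_transitive_1n_convergent, canonical_geach. reflexivity.
Qed.

Theorem corollary42 :
  (forall (X : frame_property -> Prop) (L : logic),
     combination X -> complete L (models_of X) -> CIP L /\ LIP L) /\
  (forall (n m : nat) (F : frame),
     1 <= n -> n <= m -> transitive_fr F -> nm_transitive n m F) /\
  List.Forall interpolation modal_cube /\
  interpolation K4_2 /\
  interpolation S4_2 /\
  interpolation Triv /\
  interpolation Verum /\
  (forall n : nat, interpolation (K4_1n n)) /\
  (forall G : nat -> nat -> nat -> nat -> Prop,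
     (forall h i j k : nat, G h i j k ->
        1 <= h /\ 1 <= i /\ 1 <= j /\ 1 <= k) ->
     interpolation (geach_logic K4 G)) /\
  (forall G : nat -> nat -> nat -> nat -> Prop,
     (forall h i j k : nat, G h i j k ->
        2 <= h /\ 1 <= i /\ 2 <= j /\ 1 <= k) ->
     interpolation (geach_logic K5 G)).
Proof.
  split; [exact interpolation_listed|].
  split.
  { intros n m F Hn Hnm H w x. apply accn_shorten; [|auto]. intros a b. apply H. }
  split.
  { unfold modal_cube.
    (* The properties defining the cube are listed without side conditions, so [constructor] closes
       each case. *)
    repeat (apply Forall_cons; [apply interpolation_logic_of; intros X P HP;
      simpl in HP; intuition (subst; constructor)|]).
    apply Forall_nil. }
  split; [exact interpolation_K4_2|].
  split; [exact interpolation_S4_2|].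
  split.
  { apply interpolation_logic_of. intros X P [<-|[]]. constructor. }
  split.
  { apply interpolation_logic_of. intros X P [<-|[]]. constructor. }
  split; [exact interpolation_K4_1n|].
  split; intros G HG.
  - apply (interpolation_geach transitive_fr G 0 1 2 0).
    + exact transitive_convergent.
    + intros X. constructor.
    + intros X h i j k HX Hg. destruct (HG h i j k Hg) as [? [? [? ?]]].
      now apply listed_convergent_transitive.
  - apply (interpolation_geach euclidean_fr G 1 0 1 1).
    + exact euclidean_convergent.
    + intros X. constructor.
    + intros X h i j k HX Hg. destruct (HG h i j k Hg) as [? [? [? ?]]].
      apply listed_convergent_shift_transitive; auto.
      (* The Euclideanness of [K5] makes shift transitivity present, whence the bounds 2 on [h] and
         [j]. *)
      intros F HF. now apply euclidean_shift_transitive, HX.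
Qed.
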